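(* Let $\{\boldsymbol{Z}_n\}$ be an irreducible, non-singular lower Hessenberg branching process with $M_{i,i+1}>0$ for all $i\ge 0$, and let $\{\mu_k\}_{k\ge0}$ and $\{a_k\}_{k\ge0}$ be the sequences computed recursively from the first and second factorial moments of the offspring distributions as in the context. Then $$0<\mu_k<\infty\quad\forall k\ge0\quad\Longleftrightarrow\quad\tilde{\boldsymbol q}=\boldsymbol 1.$$ Moreover, when $\tilde{\boldsymbol q}=\boldsymbol 1$, if $\sup_k a_k/\mu_k<\infty$ and $\inf_k\sum_{\{\boldsymbol v:\,v_{k+1}\ge2\}}p_k(\boldsymbol v)>0$, then $$\sum_{k=0}^\infty\frac1{m_{0\to k}}=\infty\quad\Longleftrightarrow\quad\boldsymbol q=\boldsymbol 1,$$ where $m_{0\to k}=\prod_{j=0}^k\mu_j$.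
   Context: Lower Hessenberg branching process (LHBP): a multitype Galton-Watson process with type set $\mathcal X=\mathbb N_0=\{0,1,2,\dots\}$, started from a single individual of type $\varphi_0$. Each individual lives one generation; independently of all others, an individual of type $i$ has at death $r_\ell$ children of type $\ell$ ($\ell\in\mathcal X$) with probability $p_i(\boldsymbol r)$, where $\boldsymbol r\in R_i:=\{\boldsymbol r\in\mathbb N_0^{\mathcal X}: r_\ell=0\ \forall \ell>i+1\}$. $\boldsymbol Z_n=(Z_{n,\ell})_{\ell\in\mathcal X}$ counts the individuals of each type in generation $n$. Progeny generating vector: $G_i(\boldsymbol s)=\sum_{\boldsymbol r\in R_i}p_i(\boldsymbol r)\prod_{k=0}^{i+1}s_k^{r_k}$. Mean progeny matrix: $M_{i,j}=\partial G_i/\partial s_j$ at $\boldsymbol 1$; second moments: $A_{k,ij}=\partial^2G_k/\partial s_i\partial s_j$ at $\boldsymbol 1$. Irreducible: in the directed graph on $\mathcal X$ with an edge $i\to j$ iff $M_{i,j}>0$ there is a path between any two vertices. Non-singular: there is $i$ with $\sum_{\boldsymbol v:|\boldsymbol v|=1}p_i(\boldsymbol v)<1$, $|\boldsymbol v|=\sum_\ell v_\ell$. Extinction probabilities: $q_i=\mathbb P(\lim_n\sum_\ell Z_{n,\ell}=0\mid\varphi_0=i)$, $\tilde q_i=\mathbb P(\lim_n Z_{n,\ell}=0\ \forall\ell\mid\varphi_0=i)$; $\boldsymbol q=(q_i)$, $\tilde{\boldsymbol q}=(\tilde q_i)$. Recursions. Write $m_{i\to k}=\prod_{j=i}^k\mu_j$,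 with the empty product $m_{k+1\to k}=1$ (empty products equal $1$, empty sums equal $0$). Then $$\mu_0=\frac{M_{0,1}}{1-M_{0,0}},\qquad a_0=\frac{\mu_0^2A_{0,00}+A_{0,11}+2\mu_0A_{0,01}}{1-M_{0,0}},$$ and for $k\ge1$, $$\mu_k=\frac{M_{k,k+1}}{1-\sum_{i=0}^kM_{k,i}\,m_{i\to k-1}},$$ $$a_k=\frac{\sum_{i=0}^kM_{k,i}\sum_{j=i}^{k-1}a_j\,m_{i\to j-1}\Big(\prod_{\ell=j+1}^k\mu_\ell^2\Big)+\sum_{i=0}^{k+1}\sum_{j=0}^{k+1}m_{i\to k}\,m_{j\to k}\,A_{k,ij}}{1-\sum_{i=0}^kM_{k,i}\,m_{i\to k-1}}.$$ The condition ''$0<\mu_k<\infty$ for all $k$'' means that the recursion for $\mu_k$ is well defined at every step with a strictly positive denominator (if a denominator is $0$, $\mu_k$ is regarded as infinite). *)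

(* Defs.v *)
From HB Require Import structures.
From mathcomp Require Import all_boot all_order all_algebra finmap.
From mathcomp Require Import all_classical all_reals all_analysis.

Set Implicit Arguments.
Unset Strict Implicit.
Unset Printing Implicit Defensive.

Import Order.TTheory GRing.Theory Num.Theory.
Import numFieldNormedType.Exports.

Local Open Scope classical_set_scope.
Local Open Scope ring_scope.
Local Open Scope ereal_scope.

(** The offspring vectors [r] allowed for a parent of type [i]: lower Hessenberg
    means that no child has a type above [i.+1]. *)
Definition hess (i : nat) : set (nat -> nat) :=
  [set r | forall l, (i.+1 < l)%N -> r l = 0%N].

(** [|r|] for [r] in [hess i]: the omitted entries are all zero. *)
Definition vsize (i : nat) (r : nat -> nat) : nat := (\sum_(l < i.+2) r l)%N.

Section ProgenyLaw.
Variables (R : realType) (p : nat -> (nat -> nat) -> R).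

(** Only the values of [p i] on [hess i] are ever used. *)
Definition progeny_law : Prop := forall i,
  (forall r, hess i r -> (0 <= p i r)%R) /\ \esum_(r in hess i) (p i r)%:E = 1.

Definition progeny_gf (i : nat) (s : nat -> R) : \bar R :=
  \esum_(r in hess i) (p i r * \prod_(l < i.+2) s l ^+ r l)%:E.

(** Partial derivative in the variable [s_j], valued in the extended reals.
    It is one-sided because a generating function is in general only defined
    on [0,1]^N, of which the vector 1 is an extreme point; at 1 the derivative
    may be [+oo]. *)
Definition left_pderiv (j : nat) (F : (nat -> R) -> \bar R) (s : nat -> R) :
    \bar R :=
  lim ((F s - F (fun l => if l == j then s l - h else s l)%R) * (h^-1)%:E
         @[h --> (0:R)^'+]).

Definition ones : nat -> R := fun=> 1%R.

Definition mean (i j : nat) : \bar R := left_pderiv j (progeny_gf i) ones.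

(** [moment2 k i j] is the entry A_{k,ij}. *)
Definition moment2 (k i j : nat) : \bar R :=
  left_pderiv i (left_pderiv j (progeny_gf k)) ones.

(** The empty path is allowed, so the case [i = j] carries no condition. *)
Definition irreducible_law : Prop := forall i j, exists s : seq nat,
  path (fun x y => 0 < mean x y) i s /\ last i s = j.

Definition non_singular : Prop := exists i,
  \esum_(v in [set v | hess i v /\ vsize i v = 1%N]) (p i v)%:E < 1.

End ProgenyLaw.

Section Recursions.
Variable R : realType.

(** The sequence [x] with [x k = F k x], for [F k] depending only on the values
    of its argument below [k]; see [course_of_valuesE]. *)
Definition values_below (F : nat -> (nat -> \bar R) -> \bar R) (k : nat) :
    seq (\bar R) :=
  iter k (fun s => rcons s (F (size s) (nth 0 s))) [::].

Definition course_of_values (F : nat -> (nat -> \bar R) -> \bar R) (k : nat) :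
    \bar R :=
  F k (nth 0 (values_below F k)).

Lemma course_of_valuesE (F : nat -> (nat -> \bar R) -> \bar R) :
  (forall k x y, (forall j, (j < k)%N -> x j = y j) -> F k x = F k y) ->
  forall k, course_of_values F k = F k (course_of_values F).
Proof.
move=> Floc k; apply: Floc => j; elim: k => // k IHk.
have sz n : size (values_below F n) = n.
  by elim: n => //= n IHn; rewrite size_rcons IHn.
rewrite ltnS leq_eqVlt /= nth_rcons sz => /predU1P[->|jk].
  by rewrite ltnn eqxx.
by rewrite jk IHk.
Qed.

(** [mprod mu i k] is m_{i->k-1}. *)
Definition mprod (mu : nat -> \bar R) (i k : nat) : \bar R :=
  \prod_(i <= j < k) mu j.

Variable p : nat -> (nat -> nat) -> R.
Local Notation M := (mean p).
Local Notation A := (moment2 p).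

Definition denom (mu : nat -> \bar R) (k : nat) : \bar R :=
  1 - \sum_(0 <= i < k.+1) M k i * mprod mu i k.

(** In [\bar R] one has [0^-1 = +oo] and [(-oo)^-1 = -oo].  Hence, when all the
    [M k k.+1] are positive, [0 < mu k < +oo] for all [k] holds exactly when
    every denominator is positive and every [M k k.+1] is finite. *)
Definition mu_step (k : nat) (mu : nat -> \bar R) : \bar R :=
  M k k.+1 / denom mu k.

Definition lh_mu : nat -> \bar R := course_of_values mu_step.

Definition a_step (k : nat) (a : nat -> \bar R) : \bar R :=
  (\sum_(0 <= i < k.+1) M k i *
     (\sum_(i <= j < k)
        a j * mprod lh_mu i j * \prod_(j.+1 <= l < k.+1) lh_mu l ^+ 2)
   + \sum_(0 <= i < k.+2) \sum_(0 <= j < k.+2)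
        mprod lh_mu i k.+1 * mprod lh_mu j k.+1 * A k i j)
  / denom lh_mu k.

Definition lh_a : nat -> \bar R := course_of_values a_step.

Lemma lh_muE k :
  lh_mu k = M k k.+1 / (1 - \sum_(0 <= i < k.+1) M k i * mprod lh_mu i k).
Proof.
apply: (course_of_valuesE (F := mu_step)) => {}k x y xy.
rewrite /mu_step /denom; congr (_ / (_ - _)).
apply: eq_bigr => i _; congr (_ * _).
by apply: eq_big_nat => j /andP[_ /xy].
Qed.

Lemma lh_aE k : lh_a k =
  (\sum_(0 <= i < k.+1) M k i *
     (\sum_(i <= j < k)
        lh_a j * mprod lh_mu i j * \prod_(j.+1 <= l < k.+1) lh_mu l ^+ 2)
   + \sum_(0 <= i < k.+2) \sum_(0 <= j < k.+2)
        mprod lh_mu i k.+1 * mprod lh_mu j k.+1 * A k i j)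
  / (1 - \sum_(0 <= i < k.+1) M k i * mprod lh_mu i k).
Proof.
apply: (course_of_valuesE (F := a_step)) => {}k x y xy.
rewrite /a_step; congr ((_ + _) / _).
apply: eq_bigr => i _; congr (_ * _).
by apply: eq_big_nat => j /andP[_ /xy ->].
Qed.

End Recursions.

Section Process.
Context {d : measure_display} {T : measurableType d} {R : realType}.
Variables (P : probability T R) (p : nat -> (nat -> nat) -> R).

(** [xi (n, i, k)] is the offspring vector of the [k]-th individual of type [i]
    in generation [n].  As [hess i] is countable, its events are all of its
    subsets. *)
Variable xi : nat * nat * nat -> T -> nat -> nat.

Definition offspring_family : Prop :=
  [/\ forall n i k w, hess i (xi (n, i, k) w),
      forall t (B : set (nat -> nat)), measurable (xi t @^-1` B),
      forall n i k r, hess i r -> P (xi (n, i, k) @^-1` [set r]) = (p i r)%:E &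
      forall (J : {fset nat * nat * nat})
             (B : nat * nat * nat -> set (nat -> nat)),
        P (\bigcap_(t in [set` J]) (xi t @^-1` B t)) =
        \prod_(t <- J) P (xi t @^-1` B t)].

(** [lhbp phi0 n l w] is Z_{n,l} for the process started from one individual
    of type [phi0].  In generation [n] only types up to [phi0 + n] can be
    present, so that the sum over the types of the parents may be truncated. *)
Fixpoint lhbp (phi0 n : nat) (l : nat) (w : T) : nat :=
  if n is n'.+1 then
    (\sum_(i < (phi0 + n').+1) \sum_(k < lhbp phi0 n' i w)
       xi (n', val i, val k) w l)%N
  else (l == phi0 : nat).

Definition global_extinction (phi0 : nat) : set T :=
  [set w | (\sum_(0 <= l <oo) ((lhbp phi0 n l w)%:R : R)%:E) @[n --> \oo]
             --> (0 : \bar R)].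

Definition local_extinction (phi0 : nat) : set T :=
  [set w | forall l, ((lhbp phi0 n l w)%:R : R) @[n --> \oo] --> (0 : R)%R].

Definition q_global (phi0 : nat) : \bar R := P (global_extinction phi0).

Definition q_local (phi0 : nat) : \bar R := P (local_extinction phi0).

End Process.

(* Main.v *)
Require Import Defs.
From HB Require Import structures.
From mathcomp Require Import all_boot all_order all_algebra finmap.
From mathcomp Require Import all_classical all_reals all_analysis.
From mathcomp Require Import measurable_realfun ring lra zify.
Import Order.TTheory GRing.Theory Num.Theory.
Import numFieldNormedType.Exports.
Local Open Scope classical_set_scope.
Local Open Scope ring_scope.
Local Open Scope ereal_scope.

(** Put [x_i = 1 / m_{0 -> i-1}].  Since the mean matrix [M] is lower Hessenberg,
    the recursion for [mu] says exactly that [x] is the solution of [M x = x],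
    [x_0 = 1], so all [mu_k] are positive and finite iff this solution is finite
    and positive.

    If it first fails at [k], then perturbing [(x_0, ..., x_k, 0, ...)] along
    [k -> k+1 -> ... -> K -> {0, ..., k}] gives a finitely supported [y >= 0] with
    [M y > y] on its support.  For small [e], [1 - e y] is a supersolution of
    [s = G(s)] dominating the probability of never visiting a given type, so that
    local extinction is not almost sure.

    Conversely, let [M x = x] with [x > 0] and let [w_i] be the probability that
    [l] is visited infinitely often from [i].  Bounding first visits gives
    [w_i <= w_l x_i / x_l], and [w <= M w].  If [w_l > 0], the maximum principle
    forces equality everywhere, hence no individual has two children, and a second
    application shows that [x] is constant and every individual has exactly one
    child, which non-singularity excludes.

    For global extinction let [w = 1 - q], the maximal solution of [w = 1 - G(1 - w)].
    A second order upper bound on [1 - G(1 - w)] shows that [x_k / w_k] drops by at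
    least a constant times [x_{k+1}], which is impossible if [sum_k x_k] diverges and
    [w] is not [0].  If the sum converges, set [S_k = sum_(j < k) a_j x_{j+1}^2 / x_j];
    this is bounded, the recursion for [a] gives [M(xS) = xS + A(x,x)], and
    [e x (1 + e S)] is for small [e] a positive lower bound for [w].

    All probabilities are obtained from the one-step identity
    [E[prod_l s_l^{Z_{N+1,l}}; E_N] = E[prod_l G_l(s)^{Z_{N,l}}; E_N]] for events [E_N]
    of the first [N] generations, without embedded processes. *)

Set Implicit Arguments.
Unset Strict Implicit.
Unset Printing Implicit Defensive.


(** * Discrete random variables and independence *)

Section DiscreteMeasurability.
Context d (T : measurableType d).

(** Every subset of [K] pulls back to an event. No sigma-algebra on [K] is involved, so the property
    is stable under every map out of [K]. *)
Definition dmeas (K : Type) (c : T -> K) :=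
  forall B : set K, measurable (c @^-1` B).

Lemma dmeas_cst (K : Type) (k : K) : dmeas (fun=> k).
Proof.
move=> B; have [Bk|nBk] := pselect (B k).
  by rewrite (_ : _ @^-1` _ = setT)//; apply/seteqP; split.
by rewrite (_ : _ @^-1` _ = set0)//; apply/seteqP; split.
Qed.

Lemma dmeas_comp (K K' : Type) (c : T -> K) (h : K -> K') :
  dmeas c -> dmeas (h \o c).
Proof. by move=> mc B; exact: (mc (h @^-1` B)). Qed.

(** On each of the countably many events [c = z] the parameter is frozen. This handles random index
    ranges, such as sums over a random number of individuals. *)
Lemma dmeas_bindE (K : countType) (c : T -> K) (B : K -> set T) :
  dmeas c -> (forall z, measurable (B z)) -> measurable [set w | B (c w) w].
Proof.
move=> mc mB.
rewrite (_ : [set w | _] = \bigcup_(z in [set: K]) (c @^-1` [set z] `&` B z)).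
  apply: countable_bigcupT_measurable => // z.
  by apply: measurableI => //; exact: mc.
apply/seteqP; split => [w Bw|w [z _ [/= <-]]//].
by exists (c w).
Qed.

Lemma dmeas_bind (K : countType) (K' : Type) (c : T -> K) (f : K -> T -> K') :
  dmeas c -> (forall z, dmeas (f z)) -> dmeas (fun w => f (c w) w).
Proof. by move=> mc mf B; exact: (dmeas_bindE mc (fun z => mf z B)). Qed.

Lemma dmeas_pair (K K' : countType) (c : T -> K) (c' : T -> K') :
  dmeas c -> dmeas c' -> dmeas (fun w => (c w, c' w)).
Proof.
move=> mc mc'; apply: (@dmeas_bind _ _ c (fun z w => (z, c' w))) => // z.
exact: (dmeas_comp (pair z)).
Qed.

Lemma dmeas_map (S : Type) (K : countType) (s : seq S) (c : S -> T -> K) :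
  (forall x, dmeas (c x)) -> dmeas (fun w => [seq c x w | x <- s]).
Proof.
move=> mc; elim: s => [|x s IHs] /=; first exact: dmeas_cst.
exact: (dmeas_comp (fun z : K * seq K => z.1 :: z.2) (dmeas_pair (mc x) IHs)).
Qed.

Lemma dmeas_sumn (S : Type) (s : seq S) (c : S -> T -> nat) :
  (forall x, dmeas (c x)) -> dmeas (fun w => \sum_(x <- s) c x w)%N.
Proof.
move=> /(dmeas_map s) /(dmeas_comp sumn); congr (dmeas _).
by apply/funext => w /=; rewrite sumnE big_map.
Qed.

Lemma dmeas_measurable (K : Type) d' (V : measurableType d') (c : T -> K)
  (h : K -> V) D : dmeas c -> measurable_fun D (h \o c).
Proof. by move=> mc mD B _; apply: measurableI => //; exact: (mc (h @^-1` B)). Qed.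

Context (R : realType) (mu : {measure set T -> \bar R}).

(** Countable additivity along the level sets of [c]. These are numbered by [choice.pickle], and the
    numbers that are not codes contribute empty sets. *)
Lemma integral_partition (K : countType) (c : T -> K) (D : set T)
    (F : T -> \bar R) :
  dmeas c -> measurable D -> measurable_fun D F -> (forall w, D w -> 0 <= F w) ->
  \int[mu]_(w in D) F w =
  \esum_(z in [set: K]) \int[mu]_(w in D `&` c @^-1` [set z]) F w.
Proof.
move=> mc mD mF F0.
pose A n := D `&` (choice.pickle \o c) @^-1` [set n].
have DA : D = \bigcup_n A n.
  apply/seteqP; split => [w Dw|w [n _ []]//].
  by exists (choice.pickle (c w)).
rewrite {1}DA ge0_integral_bigcup//; first last.
- apply/trivIsetP => i j _ _ ij; apply/eqP/negPn/negP => /set0P[w].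
  by rewrite /A /= => -[[_ /= h1] [_ /= h2]]; rewrite -h1 -h2 eqxx in ij.
- by move=> w; rewrite -DA; exact: F0.
- by rewrite -DA.
- by move=> k; apply: measurableI => //; exact: (dmeas_comp choice.pickle mc).
rewrite nneseries_esumT; last first.
  by move=> n; apply: integral_ge0 => w [/F0].
rewrite (esumID (range (@choice.pickle K))); last first.
  by move=> n _; apply: integral_ge0 => w [/F0].
rewrite setTI [X in _ + X]esum1 ?adde0; last first.
  move=> n [_ nn]; rewrite (_ : A n = set0) ?integral_set0//.
  by apply/seteqP; split => // w [_ /= wn]; apply: nn; exists (c w).
rewrite (@reindex_esum _ _ _ [set: K] _ (@choice.pickle K)); last first.
  split; [by move=> x _; exists x|move=> x y _ _; exact: (pcan_inj choice.pickleK)|].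
  by move=> n [x _ <-]; exists x.
apply: eq_esum => z _; congr (integral _ _ _).
rewrite /A; congr (_ `&` _); apply/seteqP; split => w /=.
  exact: (pcan_inj choice.pickleK).
by move=> ->.
Qed.

End DiscreteMeasurability.

Section Independence.
Context (d : measure_display) (T : measurableType d) (R : realType).
Variables (P : probability T R) (p : nat -> (nat -> nat) -> R).
Variable xi : nat * nat * nat -> T -> nat -> nat.
Hypothesis hxi : offspring_family P p xi.

Let mxi t : dmeas (xi t). Proof. by case: hxi => _ + _ _ => /(_ t). Qed.

(** Events depending on finitely many coordinates in [I]: a pi-system that generates the
    sigma-algebra of these coordinates. *)
Definition cylinders (I : set (nat * nat * nat)) : set (set T) :=
  [set E | exists (J : {fset nat * nat * nat})
      (B : nat * nat * nat -> set (nat -> nat)),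
    [set` J] `<=` I /\ E = \bigcap_(t in [set` J]) (xi t @^-1` B t)].

Lemma cylinders_setT I : cylinders I setT.
Proof.
exists fset0, (fun=> setT); split; first by move=> t /=; rewrite inE.
by rewrite set_fset0 bigcap_set0.
Qed.

Lemma cylinders_setI I : setI_closed (cylinders I).
Proof.
move=> E E' [J [B [JI ->]]] [J' [B' [J'I ->]]].
exists (J `|` J')%fset.
exists (fun t => [set r | (t \in J -> B t r) /\ (t \in J' -> B' t r)]); split.
  by move=> t; rewrite /= inE => /orP[/JI|/J'I].
apply/seteqP; split => w.
  by move=> [h h'] t _ /=; split => [/h|/h'].
move=> h; split=> t /= tJ; have := h t; rewrite /= inE tJ ?orbT => /(_ isT)[] h1 h2.
  exact: h1.
exact: h2.
Qed.

Lemma cylinders_measurable I : cylinders I `<=` measurable.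
Proof.
move=> E [J [B [_ ->]]]; by apply: fin_bigcap_measurable => // t _; exact: mxi.
Qed.

Lemma sub_measurable_cyl I E : <<s cylinders I >> E -> measurable E.
Proof.
exact: (smallest_sub (@sigma_algebra_measurable _ T) (@cylinders_measurable I)).
Qed.

Lemma sub_cyl I I' : I `<=` I' -> <<s cylinders I >> `<=` <<s cylinders I' >>.
Proof.
move=> II'; apply: sub_sigma_algebra2 => E [J [B [JI ->]]].
by exists J, B; split => // t /JI /II'.
Qed.

Lemma cyl_xi I t : I t -> @dmeas _ (g_sigma_algebraType (cylinders I)) _ (xi t).
Proof.
move=> It B; apply: sub_sigma_algebra; exists [fset t]%fset, (fun=> B); split.
  by move=> t'; rewrite /= inE => /eqP ->.
by rewrite set_fset1 bigcap_set1.
Qed.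

(** Both sides are finite measures in [E]; they agree on the cylinders over [I] by the product
    formula, hence on the sigma-algebra that these generate. *)
Lemma cyl_indep I t B E : ~ I t -> <<s cylinders I >> E ->
  P (E `&` xi t @^-1` B) = P E * P (xi t @^-1` B).
Proof.
move=> nIt sE.
have mB : measurable (xi t @^-1` B) by exact: mxi.
have PBfin : P (xi t @^-1` B) \is a fin_num by exact: fin_num_measure.
have b0 : (0 <= fine (P (xi t @^-1` B)))%R by exact: fine_ge0.
suff : mrestr P mB E = mscale (NngNum b0) P E.
  by rewrite /mrestr /mscale /= fineK// => ->; rewrite muleC.
apply: (g_sigma_algebra_measure_unique (cylinders I) _ (fun=> setT)) => //.
- exact: cylinders_measurable.
- by move=> _; exact: cylinders_setT.
- by apply/seteqP; split => // w _; exists 0%N.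
- exact: cylinders_setI.
- move=> A [J [C [JI ->]]]; rewrite /mrestr /mscale /=.
  have tJ : t \notin J by apply/negP => /JI.
  have hind : forall (J : {fset nat * nat * nat}) B,
    P (\bigcap_(t in [set` J]) (xi t @^-1` B t)) =
        \prod_(t <- J) P (xi t @^-1` B t) by case: hxi.
  rewrite -[RHS]/((fine (P (xi t @^-1` B)))%:E *
    P (\bigcap_(t in [set` J]) (xi t @^-1` C t))).
  rewrite fineK// hind.
  (* The event on [t] is merged into the cylinder as one more coordinate, which is new because [t]
     is outside [I]. *)
  transitivity (P (\bigcap_(t' in [set` (t |` J)%fset])
     (xi t' @^-1` (if t' == t then B else C t')))).
    congr (P _); apply/seteqP; split => w.
      move=> [h1 h2] t' /=; rewrite !inE; case: eqP => [->//|_ /= t'J].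
      exact: h1.
    move=> h; split; last first.
      by have /= := h t; rewrite !inE eqxx; apply.
    move=> t' /= t'J; have /= := h t'; rewrite !inE t'J orbT => /(_ isT).
    by case: eqP => // tt'; rewrite -tt' t'J in tJ.
  rewrite hind big_fsetU1//= eqxx; congr (_ * _).
  apply: eq_big_seq => t' t'J; case: eqP => // tt'; by rewrite -tt' t'J in tJ.
- move=> k; rewrite /mrestr; apply: le_lt_trans (ltry 1).
  by apply: probability_le1; exact: measurableI.
Qed.

End Independence.


Lemma hess_prod (R : realType) (i m : nat) (s : nat -> R) (r : nat -> nat) :
  hess i r -> (i.+2 <= m)%N ->
  (\prod_(l < m) s l ^+ r l = \prod_(l < i.+2) s l ^+ r l)%R.
Proof.
move=> hr im; rewrite -!(big_mkord predT (fun l => s l ^+ r l)%R).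
rewrite (big_cat_nat _ im)//= [X in (_ * X)%R]big1_seq ?mulr1// => l.
by rewrite mem_index_iota => /andP[_ /andP[il _]]; rewrite hr// expr0.
Qed.

Definition box (R : realType) (s : nat -> R) := forall l, (0 <= s l <= 1)%R.

Lemma prod_box (R : realType) (I : eqType) (s : seq I) (F : I -> R) :
  (forall i, i \in s -> 0 <= F i <= 1)%R -> (0 <= \prod_(i <- s) F i <= 1)%R.
Proof.
move=> F01; rewrite big_seq; elim/big_ind : _ => //.
- by rewrite ler01 lexx.
- by move=> x y /andP[x0 x1] /andP[y0 y1]; rewrite mulr_ge0//= mulr_ile1.
Qed.

Lemma expr_box (R : realType) (x : R) n : (0 <= x <= 1)%R -> (0 <= x ^+ n <= 1)%R.
Proof. by move=> /andP[x0 x1]; rewrite exprn_ge0//= exprn_ile1. Qed.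

Lemma prodX_box (R : realType) n (s : nat -> R) (r : nat -> nat) :
  box s -> (0 <= \prod_(l < n) s l ^+ r l <= 1)%R.
Proof. by move=> bs; apply: prod_box => i _; exact: expr_box. Qed.

(** * Probability generating functions along the process *)

Definition gf (R : realType) (p : nat -> (nat -> nat) -> R) (i : nat)
  (s : nat -> R) : R := fine (progeny_gf p i s).

Section ProductIntegrals.
Context (d : measure_display) (T : measurableType d) (R : realType).
Variables (P : probability T R) (p : nat -> (nat -> nat) -> R).
Variable xi : nat * nat * nat -> T -> nat -> nat.
Hypothesis hxi : offspring_family P p xi.

Lemma hess_xi t w : hess t.1.2 (xi t w).
Proof. by case: t => [[n i] k]; case: hxi. Qed.

Lemma dmeas_xi t : dmeas (xi t). Proof. by case: hxi => _ + _ _ => /(_ t). Qed.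

(** Functions on [nat] do not form a countable type. The first [i.+2] entries are a point of the
    countable type [seq nat], and they determine a vector in [hess i]. *)
Definition xicode (t : nat * nat * nat) (r : nat -> nat) := mkseq r t.1.2.+2.

Lemma xicode_inj t r r' : hess t.1.2 r -> hess t.1.2 r' ->
  xicode t r = xicode t r' -> r = r'.
Proof.
move=> hr hr' rr'; apply/funext => l; have [lt|lt] := ltnP l t.1.2.+2.
  by have := congr1 (nth 0%N ^~ l) rr'; rewrite !nth_mkseq.
by rewrite hr// hr'.
Qed.

Lemma dmeas_xicode t : dmeas (xicode t \o xi t).
Proof. exact/dmeas_comp/dmeas_xi. Qed.

(** Replaces sums over the law by expectations of an offspring variable, to which monotone
    convergence and linearity apply. *)
Lemma law_integral n i k (F : (nat -> nat) -> R) : (forall r, 0 <= F r)%R ->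
  \esum_(r in hess i) (p i r * F r)%:E = \int[P]_w (F (xi (n, i, k) w))%:E.
Proof.
move=> F0; pose t := (n, i, k).
have mF : measurable_fun setT (fun w => (F (xi t w))%:E).
  exact: (dmeas_measurable (fun r => (F r)%:E) (dmeas_xi t)).
rewrite (integral_partition P (dmeas_xicode t))//; last first.
  by move=> w _; rewrite lee_fin.
have i0 z : 0 <= \int[P]_(w in setT `&` (xicode t \o xi t) @^-1` [set z])
    (F (xi t w))%:E by apply: integral_ge0 => w _; rewrite lee_fin.
rewrite (esumID [set z | size z = i.+2])// setTI [X in _ + X]esum1 ?adde0; last first.
  move=> z [_ nz]; rewrite (_ : _ `&` _ = set0) ?integral_set0//.
  by apply/seteqP; split => // w [_ /= wz]; apply: nz; rewrite /= -wz; exact: size_mkseq.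
rewrite (@reindex_esum _ _ _ (hess i) _ (xicode t)); last first.
  split.
  - by move=> r _; exact: size_mkseq.
  - by move=> r r' /set_mem hr /set_mem hr' /(@xicode_inj t) ->.
  - move=> z /= sz; exists (nth 0%N z); last by rewrite /xicode /= -sz mkseq_nth.
    by move=> l il; rewrite nth_default// sz.
apply: eq_esum => r hr.
have -> : [set: T] `&` (xicode t \o xi t) @^-1` [set xicode t r] = xi t @^-1` [set r].
  apply/seteqP; split => w /=; last by move=> ->.
  move=> [_ wr]; apply: (@xicode_inj t) => //; exact: hess_xi.
transitivity (\int[P]_(w in xi t @^-1` [set r]) (cst (F r)%:E) w).
  rewrite integral_cst; last exact: dmeas_xi.
  by case: hxi => _ _ hp _; rewrite [X in _ * X](hp n i k r hr) -EFinM mulrC.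
by apply: eq_integral => w; rewrite inE /= => ->.
Qed.

Lemma law_prob n i k (B : set (nat -> nat)) :
  \esum_(r in [set r | hess i r /\ B r]) (p i r)%:E = P (xi (n, i, k) @^-1` B).
Proof.
have mB : measurable (xi (n, i, k) @^-1` B) by exact: dmeas_xi.
rewrite -[X in P X]setIT -integral_indic//.
transitivity (\int[P]_w (\1_B (xi (n, i, k) w) : R)%:E); last first.
  by apply: eq_integral => w _; rewrite /= !indicE.
rewrite -law_integral; last by move=> r; rewrite indicE.
rewrite (_ : [set r | _] = hess i `&` B)// esum_mkcondr.
apply: eq_esum => r _; rewrite indicE.
by case: ifPn; rewrite ?mulr1 ?mulr0.
Qed.

(** Induction on [s]: once the first variable is fixed through its code [z], its event [C] is
    absorbed into [E] and its index into [I], and [cyl_indep] factors out the probability of [C]. *)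
Lemma integral_xi_indep (f : nat * nat * nat -> (nat -> nat) -> R)
    (s : seq (nat * nat * nat)) I E :
  (forall t r, 0 <= f t r)%R -> uniq s -> (forall t, t \in s -> ~ I t) ->
  <<s cylinders xi I >> E ->
  \int[P]_(w in E) (\prod_(t <- s) f t (xi t w))%:E =
  P E * \prod_(t <- s) \int[P]_w (f t (xi t w))%:E.
Proof.
move=> f0; elim: s I E => [|t s IHs] I E /=.
  move=> _ _ sE; rewrite big_nil mule1; under eq_integral do rewrite big_nil.
  by rewrite (integral_cst P (sub_measurable_cyl hxi sE) 1) mul1e.
move=> /andP[ts us] sI sE.
have mE := sub_measurable_cyl hxi sE.
have mf D : measurable_fun D (fun w => \prod_(t <- s) f t (xi t w))%R.
  apply: measurable_prod => t' _; exact: (dmeas_measurable (f t') (dmeas_xi t')).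
have mft D : measurable_fun D (fun w => f t (xi t w)).
  exact: (dmeas_measurable (f t) (dmeas_xi t)).
under eq_integral do rewrite big_cons.
rewrite (integral_partition P (dmeas_xicode t))//; first last.
- by move=> w _; rewrite lee_fin mulr_ge0// prodr_ge0.
- by apply/measurable_EFinP; apply: measurable_funM.
rewrite big_cons; set Q := \prod_(_ <- s) _.
have Q0 : 0 <= Q.
  by rewrite /Q; elim/big_ind : _ => // [x y|t' _]; [exact: mule_ge0|
    apply: integral_ge0 => w _; rewrite lee_fin].
rewrite (muleC _ Q) muleA -ge0_integralZl//; first last.
- exact: mule_ge0.
- by move=> w _; rewrite lee_fin.
- exact/measurable_EFinP.
rewrite (integral_partition P (dmeas_xicode t))//; first last.
- by move=> w _; rewrite !mule_ge0// lee_fin.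
- by apply: measurable_funeM; exact/measurable_EFinP.
apply: eq_esum => z _; rewrite setTI.
set C := _ @^-1` [set z].
have [[w0 /= w0z]|nC] := pselect (exists w, (xicode t \o xi t) w = z); last first.
  rewrite (_ : C = set0) ?setI0 ?integral_set0//.
  by apply/seteqP; split => // w wz; apply: nC; exists w.
have xiC w : C w -> xi t w = xi t w0.
  by rewrite /C /= => h; apply: (@xicode_inj t); rewrite ?h//; exact: hess_xi.
have CE : C = xi t @^-1` [set xi t w0].
  by apply/seteqP; split => w //=; [exact: xiC|rewrite /C /= => ->].
have mC : measurable C by exact: dmeas_xicode.
transitivity ((f t (xi t w0))%:E *
    \int[P]_(w in E `&` C) (\prod_(t <- s) f t (xi t w))%:E).
  rewrite -ge0_integralZl//.
  - by apply: eq_integral => w; rewrite inE => -[_ /xiC ->]; rewrite EFinM.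
  - exact: measurableI.
  - exact/measurable_EFinP.
  - by move=> w _; rewrite lee_fin prodr_ge0.
  - by rewrite lee_fin.
have sub t' : I t' -> (I `|` [set t]) t' by left.
rewrite (IHs (I `|` [set t]) (E `&` C))//; first last.
- apply: (@measurableI _ (g_sigma_algebraType (cylinders xi (I `|` [set t])))).
    by apply: (sub_cyl sub).
  by rewrite CE; apply: cyl_xi; right.
- move=> t' t's [|/= tt']; first by apply: sI; rewrite inE t's orbT.
  by rewrite -tt' t's in ts.
have -> : P (E `&` C) = P E * P C.
  by rewrite CE; apply: (cyl_indep hxi _ _ sE); apply: sI; rewrite inE eqxx.
transitivity (\int[P]_(w in C) cst (P E * Q * (f t (xi t w0))%:E) w); last first.
  by apply: eq_integral => w; rewrite inE => /xiC ->.
rewrite integral_cst// -/Q [RHS]muleAC [RHS]muleC; congr (_ * _).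
by rewrite muleAC.
Qed.

End ProductIntegrals.


Section GenFun.
Context (d : measure_display) (T : measurableType d) (R : realType).
Variables (P : probability T R) (p : nat -> (nat -> nat) -> R).
Variable xi : nat * nat * nat -> T -> nat -> nat.
Hypothesis hxi : offspring_family P p xi.

Lemma measurable_xi_fun t (F : (nat -> nat) -> R) D :
  measurable_fun D (fun w => F (xi t w)).
Proof. exact: (dmeas_measurable F (dmeas_xi hxi t)). Qed.

Lemma measurable_xi_EFin t (F : (nat -> nat) -> R) D :
  measurable_fun D (fun w => (F (xi t w))%:E).
Proof. exact/measurable_EFinP/measurable_xi_fun. Qed.

Lemma integral_le1 (F : T -> R) : measurable_fun setT F ->
  (forall w, 0 <= F w <= 1)%R -> \int[P]_w (F w)%:E <= 1.
Proof.
move=> mF F01; have : \int[P]_w (F w)%:E <= \int[P]_w cst 1 w.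
  apply: ge0_le_integral => //.
  - by move=> w _; rewrite lee_fin; case/andP: (F01 w).
  - exact/measurable_EFinP.
  - by move=> w _; rewrite lee_fin; case/andP: (F01 w).
move=> /le_trans; apply; rewrite integral_cst// mul1e; exact: probability_le1.
Qed.

Lemma gf_integral n i k s : box s ->
  \int[P]_w (\prod_(l < i.+2) s l ^+ xi (n, i, k) w l)%:E = (gf p i s)%:E.
Proof.
move=> bs; pose F (r : nat -> nat) := (\prod_(l < i.+2) s l ^+ r l)%R.
have F01 r : (0 <= F r <= 1)%R by exact: (prodX_box i.+2 r bs).
have F0 r : (0 <= F r)%R by case/andP: (F01 r).
have /esym E := law_integral hxi n i k F0.
rewrite E /gf /progeny_gf fineK// -E ge0_fin_numE; last first.
  by apply: integral_ge0 => w _; rewrite lee_fin.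
apply: le_lt_trans (ltry 1); apply: integral_le1 => //.
exact: (measurable_xi_fun _ F).
Qed.

Lemma gf_box s : box s -> box (gf p ^~ s).
Proof.
move=> bs i; rewrite -!lee_fin -(gf_integral 0 i 0 bs); apply/andP; split.
  apply: integral_ge0 => w _; rewrite lee_fin.
  by case/andP: (prodX_box i.+2 (xi (0%N, i, 0%N) w) bs).
apply: integral_le1 => [|w]; last exact: (prodX_box _ (xi _ w)).
exact: (measurable_xi_fun _ (fun r => \prod_(l < i.+2) s l ^+ r l)%R).
Qed.

Lemma gf_le s t i : box s -> box t -> (forall j, (j <= i.+1)%N -> s j <= t j)%R ->
  (gf p i s <= gf p i t)%R.
Proof.
move=> bs bt st; rewrite -lee_fin -(gf_integral 0 i 0 bs) -(gf_integral 0 i 0 bt).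
apply: ge0_le_integral => //.
- by move=> w _; rewrite lee_fin; case/andP: (prodX_box i.+2 (xi (0%N, i, 0%N) w) bs).
- exact: (measurable_xi_EFin _ (fun r => \prod_(l < i.+2) s l ^+ r l)%R).
- exact: (measurable_xi_EFin _ (fun r => \prod_(l < i.+2) t l ^+ r l)%R).
- move=> w _; rewrite lee_fin; apply: ler_prod => l _.
  have /andP[s0 _] := bs l.
  have /andP[t0 _] := bt l.
  have slt : (s l <= t l)%R by apply: st; rewrite -ltnS.
  by rewrite exprn_ge0//= lerXn2r.
Qed.

(** The history before generation [N] reproduces: [zcode N] is measurable for it, and the offspring
    of generation [N] is independent of it. *)
Definition past N : set (set T) :=
  <<s cylinders xi [set t : nat * nat * nat | (t.1.1 < N)%N] >>.

Local Notation pastType N :=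
  (g_sigma_algebraType (cylinders xi [set t : nat * nat * nat | (t.1.1 < N)%N])).

Lemma past_measurable N E : past N E -> measurable E.
Proof. exact: (sub_measurable_cyl hxi). Qed.

Lemma past_setT N : past N setT.
Proof. exact: (@measurableT _ (pastType N)). Qed.

Lemma past_setI N E F : past N E -> past N F -> past N (E `&` F).
Proof. exact: (@measurableI _ (pastType N)). Qed.

Lemma past_le N E : past N E -> past N.+1 E.
Proof. by apply: sub_cyl => t /=; exact: ltnW. Qed.

Lemma past_xi N i k : @dmeas _ (pastType N.+1) _ (xi (N, i, k)).
Proof. apply: cyl_xi; exact: ltnSn. Qed.

Lemma dmeas_past N K (c : T -> K) : @dmeas _ (pastType N) _ c -> dmeas c.
Proof. by move=> mc B; apply: (@past_measurable N); exact: (mc B). Qed.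

Variable phi0 : nat.
Local Notation Z := (lhbp xi phi0).

Lemma lhbp_support n l w : (phi0 + n < l)%N -> Z n l w = 0%N.
Proof.
elim: n l => [|n IHn] l /=; first by rewrite addn0; case: ltngtP.
move=> nl; apply: big1 => i _; apply: big1 => k _.
have := @hess_xi _ _ _ _ _ _ hxi (n, val i, val k) w; apply => /=.
by have := ltn_ord i; lia.
Qed.

Definition zcode N w := mkseq (fun l => Z N l w) (phi0 + N).+1.

(** The summation ranges of the recursion are random; they are frozen at the value of [zcode N],
    which lists all types that can be present. *)
Lemma past_lhbp N l : @dmeas _ (pastType N) _ (Z N l).
Proof.
elim: N l => [|N IHN] l; first exact: dmeas_cst.
have mc : @dmeas _ (pastType N.+1) _ (zcode N).
  apply: (dmeas_map (T := pastType N.+1) _ (c := Z N)) => x B; exact: (past_le (IHN x B)).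
pose f (z : seq nat) (w : T) := (\sum_(i <- index_iota 0 (phi0 + N).+1)
   \sum_(k <- index_iota 0 (nth 0 z i)) xi (N, i, k) w l)%N.
suff -> : Z N.+1 l = fun w => f (zcode N w) w.
  apply: (dmeas_bind (T := pastType N.+1)) => // z.
  apply: (dmeas_sumn (T := pastType N.+1)) => i.
  apply: (dmeas_sumn (T := pastType N.+1)) => k.
  exact: (dmeas_comp (T := pastType N.+1) (fun r => r l) (@past_xi N i k)).
apply/funext => w; rewrite /f /= big_mkord; apply: eq_bigr => i _.
by rewrite big_mkord nth_mkseq.
Qed.

Lemma past_zcode N : @dmeas _ (pastType N) _ (zcode N).
Proof. by apply: (dmeas_map (T := pastType N) _ (c := Z N)) => x; exact: past_lhbp. Qed.

Lemma dmeas_zcode N : dmeas (zcode N).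
Proof. apply: (@dmeas_past N); exact: past_zcode. Qed.

Lemma dmeas_lhbp N l : dmeas (Z N l).
Proof. apply: (@dmeas_past N); exact: past_lhbp. Qed.

Definition zprod N (s : nat -> R) w : R := \prod_(l < (phi0 + N).+1) s l ^+ Z N l w.

Lemma zprod_box N s w : box s -> (0 <= zprod N s w <= 1)%R.
Proof. exact: (prodX_box _ (fun l => Z N l w)). Qed.

Lemma measurable_zprod N s D : measurable_fun D (fun w => (zprod N s w)%:E).
Proof.
pose h (z : seq nat) := (\prod_(l < (phi0 + N).+1) s l ^+ nth 0%N z l)%R.
suff -> : (fun w => (zprod N s w)%:E) = (fun w => (h (zcode N w))%:E).
  exact: (dmeas_measurable (fun z => (h z)%:E) (@dmeas_zcode N)).
apply/funext => w; congr EFin; apply: eq_bigr => l _.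
by rewrite nth_mkseq.
Qed.

(** Given the value [z] of [zcode N], the list [L] of the parents is deterministic. The product over
    the children regroups by parent, and by independence each parent of type [i] contributes a
    factor [gf p i s]. *)
Lemma one_step N s E : box s -> past N E ->
  \int[P]_(w in E) (zprod N.+1 s w)%:E =
  \int[P]_(w in E) (zprod N (gf p ^~ s) w)%:E.
Proof.
move=> bs sE; have mE := past_measurable sE.
have Z0 M t w : box t -> 0 <= (zprod M t w)%:E.
  by move=> /(@zprod_box M _ w); rewrite lee_fin => /andP[].
rewrite !(integral_partition P (@dmeas_zcode N))//; first last.
- by move=> w _; exact: Z0.
- exact: measurable_zprod.
- by move=> w _; apply: Z0; exact: gf_box.
- exact: measurable_zprod.
apply: eq_esum => z _; set C := _ @^-1` [set z].
have sC : past N (E `&` C) by apply: past_setI => //; exact: (@past_zcode N).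
pose L := [seq (N, i, k) | i <- index_iota 0 (phi0 + N).+1,
                           k <- index_iota 0 (nth 0%N z i)].
pose f (t : nat * nat * nat) (r : nat -> nat) :=
  (\prod_(l < t.1.2.+2) s l ^+ r l)%R.
have ZC w i : C w -> (i < (phi0 + N).+1)%N -> Z N i w = nth 0%N z i.
  by rewrite /C /= => <- iI; rewrite nth_mkseq.
transitivity (\int[P]_(w in E `&` C) (\prod_(t <- L) f t (xi t w))%:E).
  apply: eq_integral => w; rewrite inE => -[_ wC]; congr EFin.
  have ZE l : (s l ^+ Z N.+1 l w = \prod_(0 <= i < (phi0 + N).+1)
      \prod_(k < Z N i w) s l ^+ xi (N, i, val k) w l)%R.
    rewrite big_mkord /= -GRing.prodrXr; apply: eq_bigr => i _.
    by rewrite -GRing.prodrXr.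
  rewrite /L big_allpairs_dep /zprod.
  under [LHS]eq_bigr do rewrite ZE.
  rewrite [LHS]exchange_big /=; apply: eq_big_seq => i; rewrite mem_index_iota => /andP[_ iI].
  rewrite [LHS]exchange_big /= -(ZC w i)// [in RHS]big_mkord; apply: eq_bigr => k _.
  rewrite /f /=; apply: hess_prod; first exact: (@hess_xi _ _ _ _ _ _ hxi (N, i, val k) w).
  by lia.
rewrite (integral_xi_indep hxi (f := f) _ _ _ sC).
- transitivity (P (E `&` C) * (\prod_(i < (phi0 + N).+1) gf p i s ^+ nth 0%N z i)%:E).
    congr (_ * _); rewrite big_allpairs_dep /= -prodEFin -(big_mkord predT
      (fun i => (gf p i s ^+ nth 0%N z i)%:E)); apply: eq_bigr => i _.
    under eq_bigr do rewrite /f /= gf_integral//.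
    by rewrite prodEFin big_const_nat subn0 -Monoid.iteropE.
  rewrite muleC -integral_cst; last exact: past_measurable sC.
  apply: eq_integral => w; rewrite inE => -[_ wC] /=; congr EFin.
  by apply: eq_bigr => i _; rewrite (ZC w).
- by move=> t r; case/andP: (prodX_box t.1.2.+2 r bs).
- apply: allpairs_uniq_dep => [|i _|]; rewrite ?iota_uniq//.
  by move=> [i k] [i' k'] _ _ /= [-> ->].
- by move=> t /allpairsPdep[i [k [_ _ ->]]] /=; rewrite ltnn.
Qed.

End GenFun.


Definition gfiter (R : realType) (p : nat -> (nat -> nat) -> R) N (s : nat -> R) :=
  iter N (fun t => gf p ^~ t) s.

(* The probability that an individual of type [i] has no descendant of type [l]
   in the generations [0, ..., m]. *)
Definition avoid (R : realType) (p : nat -> (nat -> nat) -> R) (l m : nat) :=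
  iter m (fun t i => (i != l)%:R * gf p i t)%R (fun i => (i != l)%:R%R).

Lemma cvg_nat0 (R : realType) (x : nat -> nat) :
  (x n)%:R%R @[n --> \oo] --> (0%R : R) <-> exists N, forall n, (N <= n)%N -> x n = 0%N.
Proof.
split => [x0|[N xN]].
  have [N _ xN] : \forall n \near \oo, ((x n)%:R < 1 :> R)%R.
    by apply: (cvgr_lt (0%R : R)).
  exists N => n Nn; have := xN n Nn; rewrite (_ : 1 = 1%:R)%R// ltr_nat.
  by case: (x n).
by apply: cvg_near_cst; exists N => // n /= /xN ->.
Qed.

(** * Extinction probabilities as limits of iterated generating functions *)

Section Extinction.
Context (d : measure_display) (T : measurableType d) (R : realType).
Variables (P : probability T R) (p : nat -> (nat -> nat) -> R).
Variable xi : nat * nat * nat -> T -> nat -> nat.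
Hypothesis hxi : offspring_family P p xi.

Lemma gfiter_box N s : box s -> box (gfiter p N s).
Proof. by move=> bs; elim: N => //= N IHN; exact: (gf_box hxi). Qed.

Lemma box_ne l : box (fun i => (i != l)%:R : R).
Proof. by move=> i; case: eqP => _ /=; rewrite ?lexx ler01. Qed.

Lemma avoid_box l m : box (avoid p l m).
Proof.
elim: m => [|m IHm] /=; first exact: box_ne.
move=> i; have /andP[a0 a1] := box_ne l i; have /andP[b0 b1] := gf_box hxi IHm i.
by rewrite mulr_ge0//= mulr_ile1.
Qed.

Variable phi0 : nat.
Local Notation Z := (lhbp xi phi0).

Lemma integral_zprod N s : box s ->
  \int[P]_w (zprod xi phi0 N s w)%:E = (gfiter p N s phi0)%:E.
Proof.
elim: N s => [|N IHN] s bs.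
  transitivity (\int[P]_w cst (s phi0)%:E w); last first.
    by rewrite integral_cst// [X in _ * X]probability_setT mule1.
  apply: eq_integral => w _; congr EFin; rewrite /zprod addn0 big_ord_recr /= eqxx expr1.
  by rewrite big1 ?mul1r// => l _; rewrite (ltn_eqF (ltn_ord l)) expr0.
rewrite (one_step hxi)//; last exact: past_setT.
by rewrite IHN ?/gfiter ?iterSr//; exact: (gf_box hxi).
Qed.

Definition dead N : set T := [set w | forall l, Z N l w = 0%N].

(** Since [0 ^+ 0 = 1], a factor is 1 exactly when its count is zero. *)
Lemma zprod0 N w : zprod xi phi0 N (fun=> 0%R) w = \1_(dead N) w :> R.
Proof.
rewrite indicE; have [Dw|nD] := pselect (dead N w).
  by rewrite mem_set//; apply: big1 => l _; rewrite Dw expr0.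
rewrite memNset//.
have [l Zl] : exists l, Z N l w != 0%N.
  apply: contrapT => /forallNP h; apply: nD => l.
  by apply/eqP/negPn/negP/h.
have lN : (l < (phi0 + N).+1)%N.
  by rewrite ltnS leqNgt; apply/negP => /(lhbp_support hxi w); exact/eqP.
by rewrite /zprod (bigD1 (Ordinal lN))//= expr0n (negPf Zl) mul0r.
Qed.

Lemma measurable_dead N : measurable (dead N).
Proof.
rewrite (_ : dead N = \bigcap_l (Z N l @^-1` [set 0%N])).
  by apply: bigcap_measurableType => l _; exact: (dmeas_lhbp hxi).
by apply/seteqP; split => [w Dw l _|w Dw l]; [exact: Dw|exact: (Dw l)].
Qed.

Lemma prob_dead N : P (dead N) = (gfiter p N (fun=> 0%R) phi0)%:E.
Proof.
rewrite -integral_zprod; last by move=> l; rewrite lexx ler01.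
rewrite -[X in P X]setIT -integral_indic//; last exact: measurable_dead.
by apply: eq_integral => w _; rewrite zprod0.
Qed.

Lemma dead_mono N n : (N <= n)%N -> dead N `<=` dead n.
Proof.
move=> /subnKC <-; elim: (n - N)%N => [|m IHm]; first by rewrite addn0.
move=> w /IHm h l; rewrite addnS /=; apply: big1 => i _; rewrite h.
by rewrite big_ord0.
Qed.

(** The totals are integers, so convergence to 0 means that they vanish eventually, and an extinct
    population stays extinct. *)
Lemma global_extinctionE : global_extinction (R := R) xi phi0 = \bigcup_N dead N.
Proof.
have sE n w : \sum_(0 <= l <oo) ((Z n l w)%:R : R)%:E =
    ((\sum_(l < (phi0 + n).+1) Z n l w)%N%:R : R)%:E.
  rewrite (nneseries_split 0 (phi0 + n).+1)//= add0n.
  rewrite eseries0 ?adde0; last first.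
    by move=> l nl _; rewrite (lhbp_support hxi).
  by rewrite big_mkord natr_sum sumEFin.
have -> : global_extinction (R := R) xi phi0 = [set w |
    (\sum_(l < (phi0 + n).+1) Z n l w)%N%:R%R @[n --> \oo] --> (0%R : R)].
  apply/seteqP; split => w; rewrite /global_extinction /=.
    under eq_fun do rewrite sE.
    exact: (fine_cvg (f := fun n => ((\sum_(l < (phi0 + n).+1) Z n l w)%N%:R : R)%:E)).
  move=> h; under eq_fun do rewrite sE.
  apply/fine_cvgP; split; last exact: h.
  exact: nearW.
apply/seteqP; split => w /=.
  move=> /cvg_nat0[N hN]; exists N => // l.
  have [lN|] := ltnP l (phi0 + N).+1; last exact: (lhbp_support hxi).
  have /eqP := hN N (leqnn N); rewrite sum_nat_eq0 => /forallP /(_ (Ordinal lN)).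
  by move=> /eqP.
move=> [N _ h]; apply/cvg_nat0; exists N => n Nn.
by apply: big1 => l _; exact: (dead_mono Nn h).
Qed.

Lemma q_globalE : exists Q : R, q_global P xi phi0 = Q%:E /\
  gfiter p N (fun=> 0%R) phi0 @[N --> \oo] --> Q.
Proof.
have mU : measurable (\bigcup_N dead N).
  by apply: bigcupT_measurable => N; exact: measurable_dead.
have Pf : P (\bigcup_N dead N) \is a fin_num by exact: fin_num_measure.
exists (fine (P (\bigcup_N dead N))); split.
  by rewrite fineK// /q_global global_extinctionE.
suff h : (gfiter p N (fun=> 0%R) phi0)%:E @[N --> \oo] -->
  (fine (P (\bigcup_N dead N)))%:E by exact: (fine_cvg h).
rewrite fineK//; under eq_fun do rewrite -prob_dead.
apply: nondecreasing_cvg_mu => //; first exact: measurable_dead.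
by move=> N n Nn; apply/subsetPset; exact: dead_mono.
Qed.

Lemma zprod_ne N l w :
  zprod xi phi0 N (fun i => (i != l)%:R)%R w = (Z N l w == 0%N)%:R :> R.
Proof.
have [lN|lN] := ltnP l (phi0 + N).+1; last first.
  rewrite (lhbp_support hxi)// eqxx; apply: big1 => i _.
  by rewrite ltn_eqF ?expr1n// (leq_trans (ltn_ord i)).
rewrite /zprod (bigD1 (Ordinal lN))//= eqxx expr0n [X in (_ * X)%R]big1 ?mulr1// => i.
by rewrite -val_eqE /= => ->; rewrite expr1n.
Qed.

(** A finite window, so that its probability is an iterate. Intersecting over [m] and then uniting
    over [N] gives the event that [l] is eventually absent. *)
Definition absent l N m : set T := [set w | forall n, (N <= n <= N + m)%N -> Z n l w = 0%N].

Lemma measurable_absent l N m : measurable (absent l N m).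
Proof.
rewrite (_ : absent l N m =
    \bigcap_(n in [set n | (N <= n <= N + m)%N]) (Z n l @^-1` [set 0%N])).
  by apply: bigcap_measurableType => n _; exact: (dmeas_lhbp hxi).
by apply/seteqP; split => [w Dw n|w Dw n]; exact: Dw.
Qed.

(** Induction on the length of the window, for all [N] and [E]: absence at time [N] joins the past
    event, and [one_step] turns the remaining window, which starts at [N.+1], into one more
    application of the generating functions. *)
Lemma integral_absent N m E l : past xi N E ->
  P (E `&` absent l N m) = \int[P]_(w in E) (zprod xi phi0 N (avoid p l m) w)%:E.
Proof.
elim: m N E => [|m IHm] N E sE.
  have mE := past_measurable hxi sE.
  rewrite setIC -integral_indic//; last exact: measurable_absent.
  apply: eq_integral => w _; rewrite zprod_ne indicE.
  have [Zw|/eqP Zw] := eqVneq (Z N l w) 0%N; last first.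
    by rewrite memNset// => /(_ N); rewrite addn0 leqnn => /(_ isT).
  by rewrite mem_set// => n; rewrite addn0 -eqn_leq => /eqP <-.
pose E' := E `&` Z N l @^-1` [set 0%N].
have sE' : past xi N E'.
  by apply: past_setI => //; exact: (@past_lhbp _ _ xi phi0 N l [set 0%N]).
have mE' := past_measurable hxi sE'.
have -> : E `&` absent l N m.+1 = E' `&` absent l N.+1 m.
  apply/seteqP; split => [w [Ew h]|w [[Ew Z0] h]].
    by split; [split => //=; apply: h; lia|move=> n hn; apply: h; lia].
  split => // n /andP[Nn nN]; have [->//|nN'] := eqVneq n N.
  by apply: h; lia.
rewrite IHm ?(one_step hxi)//; last 2 first.
- exact: avoid_box.
- exact: past_le.
rewrite integral_mkcondr; apply: eq_integral => w _.
rewrite patchE /zprod /=.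
have -> : (\prod_(i < (phi0 + N).+1) ((i != l :> nat)%:R * gf p i (avoid p l m)) ^+ Z N i w =
   (Z N l w == 0%N)%:R * \prod_(i < (phi0 + N).+1) gf p i (avoid p l m) ^+ Z N i w)%R.
  by rewrite -(zprod_ne N l w) -big_split /=; apply: eq_bigr => i _; rewrite exprMn.
case: ifPn => [|h].
  by rewrite inE /= => ->; rewrite eqxx mul1r.
case: eqP => [h0|_]; last by rewrite mul0r.
by move/negP: h; rewrite inE.
Qed.

Lemma prob_absent l N m : P (absent l N m) = (gfiter p N (avoid p l m) phi0)%:E.
Proof.
rewrite -integral_zprod; last exact: avoid_box.
by rewrite -integral_absent ?setTI//; exact: past_setT.
Qed.

(** [V l N] is the probability that type [l] is absent from generation [N] on, and [W l] that it is
    eventually absent. Local extinction is the intersection of the latter events over the countably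
    many [l], hence almost sure iff each of them is. *)
Lemma q_localE : exists V : nat -> nat -> R, exists W : nat -> R,
  [/\ forall l N, gfiter p N (avoid p l m) phi0 @[m --> \oo] --> V l N,
      forall l, V l N @[N --> \oo] --> W l &
      q_local P xi phi0 = 1 <-> forall l, W l = 1%R].
Proof.
pose A l N := \bigcap_m absent l N m.
pose B l := \bigcup_N A l N.
have mA l N : measurable (A l N).
  by apply: bigcap_measurableType => m _; exact: measurable_absent.
have mB l : measurable (B l) by exact: bigcupT_measurable.
have Pf C : measurable C -> P C \is a fin_num by move=> mC; exact: fin_num_measure.
exists (fun l N => fine (P (A l N))), (fun l => fine (P (B l))); split.
- move=> l N; suff h : (gfiter p N (avoid p l m) phi0)%:E @[m --> \oo] -->
    (fine (P (A l N)))%:E by exact: (fine_cvg h).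
  rewrite fineK ?Pf//; under eq_fun do rewrite -prob_absent.
  apply: nonincreasing_cvg_mu => //.
  + by apply: le_lt_trans (ltry 1); apply: probability_le1; exact: measurable_absent.
  + by move=> m; exact: measurable_absent.
  + exact: (mA l N).
  + by move=> m n mn; apply/subsetPset => w h k hk; apply: h; lia.
- move=> l; suff h : P (A l N) @[N --> \oo] --> (fine (P (B l)))%:E.
    exact: (fine_cvg h).
  rewrite fineK ?Pf//; apply: nondecreasing_cvg_mu => //; first exact: (mB l).
  move=> N n Nn; apply/subsetPset => w h m _ k hk; apply: (h (n + m)%N) => //.
  by lia.
have LE : local_extinction (R := R) xi phi0 = \bigcap_l B l.
  apply/seteqP; split => w h.
    move=> l _; have /cvg_nat0[N hN] := h l; exists N => // m _ n /andP[Nn _].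
    exact: hN.
  move=> l; apply/cvg_nat0; have [N _ hN] := h l I; exists N => n Nn.
  by apply: (hN n I); lia.
have mL : measurable (local_extinction (R := R) xi phi0).
  by rewrite LE; apply: bigcap_measurableType.
rewrite /q_local; split => [L1 l|W1].
  have : P (B l) = 1; last by move=> ->.
  apply/eqP; rewrite eq_le probability_le1//= -L1; apply: le_measure; rewrite ?inE//.
  by rewrite LE; exact: bigcap_inf.
suff : P (~` local_extinction (R := R) xi phi0) = 0.
  rewrite probability_setC//.
  have := Pf _ mL; case: (P _) => // r _ /eqP.
  by rewrite -EFinB eqe subr_eq0 => /eqP <-.
rewrite LE setC_bigcap; apply/eqP; rewrite eq_le measure_ge0 andbT.
have mBc l : measurable (~` B l) by exact: measurableC.
have := @measure_sigma_subadditive _ _ _ P (\bigcup_l ~` B l) (fun l => ~` B l)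
  mBc (bigcupT_measurable _ mBc) (@subset_refl _ _).
move=> /le_trans; apply.
rewrite eseries0// => l _ _.
transitivity (1 - P (B l)); first exact: probability_setC.
by rewrite -(fineK (Pf _ (mB l))) W1 subee.
Qed.

End Extinction.


(** * Moments of the offspring laws and bounds on their generating functions *)

Section ProductBounds.
Local Open Scope ring_scope.
Variable R : realType.
Implicit Types (w : nat -> R) (r : nat -> nat).

(** The first two Bonferroni inequalities for a product [q] of factors [1 - x], where [L] is the sum
    of the [x] and [V] that of their squares; [(L ^+ 2 - V) / 2] is the sum over pairs. *)
Definition bonferroni (q L V : R) :=
  [/\ 0 <= q <= 1, 0 <= L, V <= L ^+ 2, 1 - L <= q & q <= 1 - L + (L ^+ 2 - V) / 2].

Lemma bonferroniM q L V x : 0 <= x <= 1 -> bonferroni q L V ->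
  bonferroni (q * (1 - x)) (L + x) (V + x ^+ 2).
Proof.
move=> /andP[x0 x1] [/andP[q0 q1] L0 VL h1 h2]; split.
- by rewrite mulr_ge0 ?subr_ge0//= mulr_ile1 ?subr_ge0// lerBlDr lerDl.
- exact: addr_ge0.
- nra.
- nra.
(* The third order term [(L ^+ 2 - V) * x / 2] has the right sign and is dropped. *)
- have : q * (1 - x) <= (1 - L + (L ^+ 2 - V) / 2) * (1 - x).
    by rewrite ler_wpM2r// subr_ge0.
  have : 0 <= (L ^+ 2 - V) * x by rewrite mulr_ge0// subr_ge0.
  lra.
Qed.

Lemma bonferroni_prod n w r : box w ->
  bonferroni (\prod_(l < n) (1 - w l) ^+ r l) (\sum_(l < n) (r l)%:R * w l)
    (\sum_(l < n) (r l)%:R * w l ^+ 2).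
Proof.
move=> bw; elim: n => [|n IHn]; rewrite ?big_ord0 ?big_ord_recr /=.
  by split; rewrite ?expr0n//=; lra.
elim: (r n) => [|m IHm]; first by rewrite !mul0r !addr0 expr0 mulr1.
rewrite exprSr -natr1 !mulrDl !mul1r !mulrA !addrA.
by apply: bonferroniM; rewrite /= -?(mulrA m%:R).
Qed.

Lemma prod_delta n a (x : nat -> R) : (a < n)%N -> \prod_(l < n) x l ^+ (l == a :> nat) = x a.
Proof.
move=> an; rewrite (bigD1 (Ordinal an))//= eqxx expr1 big1 ?mulr1// => i.
by rewrite -val_eqE /= => /negPf ->.
Qed.

Lemma sum_delta n a (x : nat -> R) : (a < n)%N -> \sum_(l < n) (l == a :> nat)%:R * x l = x a.
Proof.
move=> an; rewrite (bigD1 (Ordinal an))//= eqxx mul1r big1 ?addr0// => i.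
by rewrite -val_eqE /= => /negPf ->; rewrite mul0r.
Qed.

(** Two individuals are split off, leaving [r'] with product [q] and linear sum [L]. Then
    [q * c >= c - (1 - q) >= c - L] for [c = (1 - w a) * (1 - w b)], whose cross term is the gain.
    For [a = b] the assumption on [r b] asks for two individuals. *)
Lemma prod_pair_ge n w r a b : box w -> (a < n)%N -> (b < n)%N ->
  (0 < r a)%N -> ((a == b) < r b)%N ->
  1 - \sum_(l < n) (r l)%:R * w l + w a * w b <= \prod_(l < n) (1 - w l) ^+ r l.
Proof.
move=> bw an bn ra rb; pose r' l := (r l - (l == a) - (l == b))%N.
have rE l : r l = (r' l + (l == a) + (l == b))%N.
  rewrite /r'; have [->|la] := eqVneq l a; last first.
    by have [->|lb] := eqVneq l b; [move: rb; case: (a == b); lia|lia].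
  by move: rb ra; have [->|ab] := eqVneq a b; lia.
have [/andP[q0 q1] _ _ h _] := bonferroni_prod n r' bw.
have -> : \sum_(l < n) (r l)%:R * w l = \sum_(l < n) (r' l)%:R * w l + w a + w b.
  rewrite -(sum_delta w an) -(sum_delta w bn) -!big_split; apply: eq_bigr => l _ /=.
  by rewrite {1}rE !natrD !mulrDl.
have -> : \prod_(l < n) (1 - w l) ^+ r l =
   \prod_(l < n) (1 - w l) ^+ r' l * (1 - w a) * (1 - w b).
  rewrite -(prod_delta (fun l => 1 - w l) an) -(prod_delta (fun l => 1 - w l) bn).
  by rewrite -!big_split; apply: eq_bigr => l _ /=; rewrite {1}rE !exprD.
move: h q0 q1; set q := \prod_(_ < _) _; set L := \sum_(_ < _) _ => h q0 q1.
have /andP[a0 a1] := bw a; have /andP[b0 b1] := bw b.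
have c1 : (1 - w a) * (1 - w b) <= 1 by rewrite mulr_ile1 ?subr_ge0// lerBlDr lerDl.
have : 0 <= (1 - q) * (1 - (1 - w a) * (1 - w b)) by rewrite mulr_ge0// subr_ge0.
lra.
Qed.

(** On the diagonal the truncated subtraction gives the factorial product [r i * (r i - 1)], correct
    also for [r i = 0]. *)
Lemma quad_form n w r :
  (\sum_(l < n) (r l)%:R * w l) ^+ 2 - \sum_(l < n) (r l)%:R * w l ^+ 2 =
  \sum_(i < n) \sum_(j < n) (r j * (r i - (i == j)))%:R * (w i * w j).
Proof.
rewrite expr2 mulr_suml.
rewrite -sumrB; apply: eq_bigr => i _.
rewrite mulr_sumr (bigD1 i)//= [RHS](bigD1 i)//= eqxx addrAC; congr (_ + _).
  case: (r i) => [|m]; first by rewrite mul0n !mul0r subrr.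
  by rewrite subn1 /= natrM -!natr1; ring.
apply: eq_bigr => j; rewrite eq_sym => /negPf ->; rewrite subn0 natrM; ring.
Qed.

End ProductBounds.


(** * One-sided derivatives of expectations of powers *)

Section Derivatives.
Context (d : measure_display) (T : measurableType d) (R : realType).
Variable P : probability T R.
Variables (c : T -> R) (n : T -> nat).
Hypotheses (c0 : forall w, (0 <= c w)%R)
  (mcn : forall f : R -> nat -> R, measurable_fun setT (fun w => f (c w) (n w))).

Let mE (f : R -> nat -> R) : measurable_fun setT (fun w => (f (c w) (n w))%:E).
Proof. exact/measurable_EFinP/mcn. Qed.

(** The polynomial form of [(x ^+ m - (x - h) ^+ m) / h], meaningful also at [h = 0], where it is
    the derivative. *)
Definition dquot (x h : R) m : R := (\sum_(i < m) x ^+ (m.-1 - i) * (x - h) ^+ i)%R.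

Lemma dquot_ge0 x h m : (0 <= h <= x)%R -> (0 <= dquot x h m)%R.
Proof.
move=> /andP[h0 hx]; apply: sumr_ge0 => i _.
by rewrite mulr_ge0 ?exprn_ge0 ?subr_ge0// (le_trans h0).
Qed.

Lemma dquot_le x h h' m : (0 <= h)%R -> (h <= h')%R -> (h' <= x)%R ->
  (dquot x h' m <= dquot x h m)%R.
Proof.
move=> h0 hh' hx; apply: ler_sum => i _.
have x0 : (0 <= x)%R by rewrite (le_trans h0)// (le_trans hh').
apply: ler_wpM2l; first exact: exprn_ge0.
by rewrite lerXn2r ?nnegrE ?subr_ge0 ?lerB// (le_trans hh').
Qed.

Lemma dquot0 x m : dquot x 0 m = (m%:R * x ^+ m.-1)%R.
Proof.
rewrite /dquot subr0 mulr_natl -[X in (_ *+ X)%R](card_ord m) -sumr_const; apply: eq_bigr => i _.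
by rewrite -exprD; congr (_ ^+ _)%R; have := ltn_ord i; lia.
Qed.

Lemma dquotE x h m : (x ^+ m = (x - h) ^+ m + h * dquot x h m)%R.
Proof.
rewrite -[LHS](subrK ((x - h) ^+ m)%R) subrXX addrC /dquot.
by congr (_ + _ * _)%R; ring.
Qed.

Lemma cvg_dquot x m (u : nat -> R) : u k @[k --> \oo] --> (0 : R)%R ->
  dquot x (u k) m @[k --> \oo] --> dquot x 0 m.
Proof.
move=> u0; apply: cvg_big => [|i _]; first exact: add_continuous.
apply: cvgM; first exact: cvg_cst.
have : (x - u k)%R @[k --> \oo] --> (x - 0)%R by apply: cvgB => //; exact: cvg_cst.
by move=> h; elim: (val i) => [|k IHk]; [exact: cvg_cst|
  under eq_fun do rewrite exprS; rewrite exprS; exact: cvgM].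
Qed.

(** The difference quotient under the integral increases as [h] decreases to 0, so monotone
    convergence gives the derivative, finite or not. Finiteness at [x] lets the common part of the
    two integrals cancel. *)
Lemma left_pderivE (j : nat) (F : (nat -> R) -> \bar R) (s : nat -> R) (x : R) :
  (0 < x)%R ->
  \int[P]_w (c w * x ^+ n w)%:E < +oo ->
  F s = \int[P]_w (c w * x ^+ n w)%:E ->
  (forall h, (0 < h < x)%R -> F (fun l => if l == j then s l - h else s l)%R =
      \int[P]_w (c w * (x - h) ^+ n w)%:E) ->
  left_pderiv j F s = \int[P]_w (c w * ((n w)%:R * x ^+ (n w).-1))%:E.
Proof.
move=> x0 finx Fs Fh.
pose f h := \int[P]_w (c w * dquot x h (n w))%:E.
pose L := \int[P]_w (c w * ((n w)%:R * x ^+ (n w).-1))%:E.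
have f0 : f 0%R = L by apply: eq_integral => w _; rewrite dquot0.
have fle h h' : (0 <= h)%R -> (h <= h')%R -> (h' <= x)%R -> f h' <= f h.
  move=> h0 hh' hx; apply: ge0_le_integral => //.
  - by move=> w _; rewrite lee_fin mulr_ge0// dquot_ge0// hx (le_trans h0).
  - exact: (mE (fun a m => a * dquot x h' m)%R).
  - exact: (mE (fun a m => a * dquot x h m)%R).
  - by move=> w _; rewrite lee_fin; apply: ler_wpM2l => //; exact: dquot_le.
have cvf : f h @[h --> (0%R)^'+] --> ereal_sup (f @` [set` `]0%R, x[]).
  apply: nonincreasing_at_right_cvge; first by rewrite bnd_simp.
  by move=> h h' /=; rewrite !in_itv /= => /andP[h0 _] /andP[_ hx] hh';
    apply: fle => //; exact: ltW.
have supE : ereal_sup (f @` [set` `]0%R, x[]) = L.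
  apply/eqP; rewrite eq_le; apply/andP; split.
    apply: ge_ereal_sup => _ [h /= + <-]; rewrite in_itv /= => /andP[h0 hx].
    by rewrite -f0; apply: fle => //; exact: ltW.
  pose u k : R := (x / k.+2%:R)%R.
  have u0 k : (0 < u k < x)%R.
    by rewrite /u divr_gt0//= ltr_pdivrMr// ltr_pMr// ltr1n.
  have uc : u k @[k --> \oo] --> (0 : R)%R.
    rewrite -(mulr0 x); apply: cvgM; first exact: cvg_cst.
    by have := @cvg_harmonic R; rewrite -cvg_shiftS.
  have fu : f (u k) @[k --> \oo] --> L.
    have -> : L = \int[P]_w (lim ((c w * dquot x (u k) (n w))%:E @[k --> \oo])).
      apply: eq_integral => w _; apply/esym/cvg_lim => //.
      apply: cvg_EFin; first exact: nearW.
      rewrite -dquot0; apply: cvgM; first exact: cvg_cst.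
      exact: cvg_dquot.
    apply: cvg_monotone_convergence => //.
    - by move=> k; exact: (mE (fun a m => a * dquot x (u k) m)%R).
    - move=> k w _; have /andP[a b] := u0 k.
      by rewrite lee_fin mulr_ge0// dquot_ge0// !ltW.
    - move=> w _ k k' kk'; rewrite lee_fin; apply: ler_wpM2l => //.
      have /andP[a b] := u0 k; have /andP[a' b'] := u0 k'.
      apply: dquot_le; [exact: ltW| |exact: ltW].
      by rewrite /u ler_pM2l// lef_pV2 ?posrE// ler_nat !ltnS.
  rewrite -(cvg_lim _ fu)//; apply: (lime_le (cvgP _ fu)).
  by apply: nearW => k; apply: ereal_sup_ubound; exists (u k) => //=; rewrite in_itv /= u0.
rewrite -/L -supE /left_pderiv; apply/cvg_lim => //.
apply: cvg_trans cvf; apply: near_eq_cvg.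
near=> h.
have h0 : (0 < h)%R by near: h; exact: nbhs_right_gt.
have hx : (h < x)%R by near: h; exact: nbhs_right_lt.
rewrite Fs Fh ?h0//.
have xh : (0 <= x - h)%R by rewrite subr_ge0 ltW.
have Ic : \int[P]_w (c w * x ^+ n w)%:E =
    \int[P]_w (c w * (x - h) ^+ n w)%:E + h%:E * f h.
  rewrite /f -ge0_integralZl_EFin//; first last.
  - exact: (mE (fun a m => a * dquot x h m)%R).
  - by move=> w _; rewrite lee_fin mulr_ge0// dquot_ge0// !ltW.
  rewrite -ge0_integralD//; first last.
  - exact: (mE (fun a m => h * (a * dquot x h m))%R).
  - by move=> w _; rewrite -EFinM lee_fin !mulr_ge0// ?dquot_ge0// !ltW.
  - exact: (mE (fun a m => a * (x - h) ^+ m)%R).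
  - by move=> w _; rewrite lee_fin mulr_ge0// exprn_ge0.
  apply: eq_integral => w _; rewrite -EFinM -EFinD; congr EFin.
  by rewrite (dquotE x h); ring.
have fin1 : \int[P]_w (c w * (x - h) ^+ n w)%:E \is a fin_num.
  rewrite ge0_fin_numE; last first.
    by apply: integral_ge0 => w _; rewrite lee_fin mulr_ge0// exprn_ge0.
  apply: le_lt_trans finx; rewrite Ic leeDl//; apply: mule_ge0; first by rewrite lee_fin ltW.
  by apply: integral_ge0 => w _; rewrite lee_fin mulr_ge0// dquot_ge0// !ltW.
rewrite Ic addeAC subee// add0e muleAC -EFinM divff ?mul1e//.
Unshelve. all: by end_near. Qed.

End Derivatives.


Lemma prod_update (R : realType) k (r : nat -> nat) (s : nat -> R) j b : hess k r ->
  (\prod_(l < k.+2) (if l == j :> nat then b else s l) ^+ r l =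
   b ^+ r j * \prod_(l < k.+2) (if l == j :> nat then 1 else s l) ^+ r l)%R.
Proof.
move=> hr; have [jk|jk] := ltnP j k.+2; last first.
  rewrite hr// expr0 mul1r; apply: eq_bigr => l _.
  by rewrite !ltn_eqF// (leq_trans (ltn_ord l)).
rewrite (bigD1 (Ordinal jk))//= [in RHS](bigD1 (Ordinal jk))//= eqxx expr1n mul1r.
by congr (_ * _)%R; apply: eq_bigr => l; rewrite -val_eqE /= => /negPf ->.
Qed.

Section Moments.
Context (d : measure_display) (T : measurableType d) (R : realType).
Variables (P : probability T R) (p : nat -> (nat -> nat) -> R).
Variable xi : nat * nat * nat -> T -> nat -> nat.
Hypothesis hxi : offspring_family P p xi.

Local Notation X i := (xi (0%N, i, 0%N)).

Let hess_X i w : hess i (X i w).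
Proof. exact: (@hess_xi _ _ _ _ _ _ hxi (0%N, i, 0%N) w). Qed.

Let mX i (F : (nat -> nat) -> R) D : measurable_fun D (fun w => (F (X i w))%:E).
Proof. exact: (measurable_xi_EFin hxi). Qed.

Let progenyE i s : (forall l, 0 <= s l)%R ->
  progeny_gf p i s = \int[P]_w (\prod_(l < i.+2) s l ^+ X i w l)%:E.
Proof.
move=> s0; apply: (law_integral hxi 0 i 0
  (F := fun r => \prod_(l < i.+2) s l ^+ r l)%R) => r.
by apply: prodr_ge0 => l _; exact: exprn_ge0.
Qed.

Definition rest k j (s : nat -> R) (r : nat -> nat) : R :=
  \prod_(l < k.+2) (if l == j :> nat then 1 else s l) ^+ r l.

Lemma left_pderiv_gf k j s : box s -> (0 < s j)%R ->
  left_pderiv j (progeny_gf p k) s =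
  \int[P]_w (rest k j s (X k w) * ((X k w j)%:R * s j ^+ (X k w j).-1))%:E.
Proof.
move=> bs sj0.
have rest01 w : (0 <= rest k j s (X k w) <= 1)%R.
  apply: (@prodX_box _ _ (fun l => if l == j then 1 else s l)%R) => l.
  by case: ifP => // _; rewrite ler01 lexx.
have updE b : (0 <= b)%R ->
   progeny_gf p k (fun l => if l == j then b else s l) =
   \int[P]_w (rest k j s (X k w) * b ^+ X k w j)%:E.
  move=> b0; rewrite progenyE; last first.
    by move=> l; case: ifP => // _; case/andP: (bs l).
  by apply: eq_integral => w _; rewrite prod_update// mulrC.
have sE : s = (fun l => if l == j then s j else s l).
  by apply/funext => l; case: eqP => // ->.
have int_eq : progeny_gf p k s = \int[P]_w (rest k j s (X k w) * s j ^+ X k w j)%:E.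
  by rewrite {1}sE updE// ltW.
apply: left_pderivE => //.
- by move=> w; case/andP: (rest01 w).
- by move=> f; exact: (measurable_xi_fun hxi _ (fun r => f (rest k j s r) (r j))).
- rewrite -int_eq progenyE; last by move=> l; case/andP: (bs l).
  by rewrite (gf_integral hxi)// ltry.
- move=> h /andP[h0 hs].
  rewrite -updE; last by rewrite subr_ge0 ltW.
  by congr (progeny_gf p k); apply/funext => l; case: eqP => // ->.
Qed.

Let box1 : box (@ones R). Proof. by move=> l; rewrite /ones /= ler01 lexx. Qed.

Lemma rest1 k j r : rest k j (@ones R) r = 1%R.
Proof. by apply: big1 => l _; case: ifP => _; rewrite expr1n. Qed.

Lemma mean_integral i j : mean p i j = \int[P]_w ((X i w j)%:R)%:E.
Proof.
rewrite /mean left_pderiv_gf; [|exact: box1|exact: ltr01].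
by apply: eq_integral => w _; rewrite rest1 mul1r /ones /= expr1n mulr1.
Qed.

Lemma mean_ge0 i j : 0 <= mean p i j.
Proof. by rewrite mean_integral; apply: integral_ge0 => w _; rewrite lee_fin. Qed.

Lemma mean_out i j : (i.+1 < j)%N -> mean p i j = 0.
Proof.
by move=> ij; rewrite mean_integral integral0_eq// => w _; rewrite hess_X.
Qed.

(** A second use of [left_pderivE], on the already differentiated function; the finite first moment
    is its finiteness assumption. For [i = j] the first derivative has lowered the exponent by one,
    hence the term [i == j]. *)
Lemma moment2_integral k i j : mean p k j < +oo ->
  moment2 p k i j = \int[P]_w ((X k w j * (X k w i - (i == j)))%:R)%:E.
Proof.
move=> fin; rewrite /moment2.
rewrite (@left_pderivE _ _ _ P (fun w => (X k w j)%:R)%R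
  (fun w => X k w i - (i == j))%N _ _ i _ (@ones R) 1%R)//.
- by apply: eq_integral => w _; rewrite expr1n mulr1 natrM.
- by move=> f; exact: (measurable_xi_fun hxi _ (fun r => f (r j)%:R%R (r i - (i == j))%N)).
- rewrite mean_integral in fin; apply: le_lt_trans fin; rewrite le_eqVlt; apply/orP; left.
  by apply/eqP/eq_integral => w _; rewrite expr1n mulr1.
- rewrite left_pderiv_gf; [|exact: box1|exact: ltr01].
  by apply: eq_integral => w _; rewrite rest1 mul1r /ones /= !expr1n mulr1.
- move=> h /andP[h0 h1]; pose s l := (if l == i then ones R l - h else ones R l)%R.
  have h1' : (0 <= 1 - h <= 1)%R by lra.
  rewrite (@left_pderiv_gf k j s); last 2 first.
  + by move=> l; rewrite /s /ones; case: eqP => // _; rewrite ler01 lexx.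
  + by rewrite /s /ones; case: eqP => // _; lra.
  apply: eq_integral => w _; congr EFin.
  have [ij|ij] := eqVneq i j.
    rewrite /s ij eqxx /ones subn1; rewrite [rest _ _ _ _]big1 ?mul1r// => l _.
    by case: eqP => _; rewrite expr1n.
  rewrite subn0 /s (eq_sym j) (negPf ij) /ones expr1n mulr1 mulrC; congr (_ * _)%R.
  transitivity (\prod_(l < k.+2) (if l == i :> nat then 1 - h else 1) ^+ X k w l)%R.
    apply: eq_bigr => l _; congr (_ ^+ _)%R; case: (eqVneq (l : nat) j) => // ->.
    by rewrite (eq_sym j) (negPf ij).
  rewrite (prod_update (fun=> 1%R))// big1 ?mulr1// => l _.
  by case: ifP => _; rewrite expr1n.
Qed.

Local Notation M := (mean p).

Lemma integral_linear i (n : nat) (c : (nat -> nat) -> nat -> nat) (y : nat -> R) :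
  (forall l, 0 <= y l)%R ->
  \int[P]_w (\sum_(l < n) (c (X i w) l)%:R * y l)%:E =
  \sum_(l < n) (\int[P]_w ((c (X i w) l)%:R)%:E) * (y l)%:E.
Proof.
move=> y0.
have mc l : measurable_fun setT (fun w => ((c (X i w) l)%:R)%:E : \bar R).
  exact: (mX _ (fun r => (c r l)%:R)%R).
under eq_integral do rewrite -sumEFin.
rewrite ge0_integral_sum//.
- apply: eq_bigr => l _; under eq_integral do rewrite EFinM muleC.
  rewrite ge0_integralZl_EFin// 1?muleC// => w _; by rewrite lee_fin.
- by move=> l; exact: (mX _ (fun r => (c r l)%:R * y l)%R).
- by move=> l w _; rewrite lee_fin mulr_ge0.
Qed.

Lemma mean_linear i (y : nat -> R) : (forall l, 0 <= y l)%R ->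
  \int[P]_w (\sum_(l < i.+2) (X i w l)%:R * y l)%:E = \sum_(l < i.+2) M i l * (y l)%:E.
Proof.
move=> y0; rewrite (integral_linear i i.+2 (fun r l => r l) y0).
by apply: eq_bigr => l _; rewrite mean_integral.
Qed.

Let box_compl (w : nat -> R) : box w -> box (fun l => 1 - w l)%R.
Proof. by move=> bw l; have := bw l; lra. Qed.

Lemma gf_compl i (w : nat -> R) : box w ->
  \int[P]_x (1 - \prod_(l < i.+2) (1 - w l) ^+ X i x l)%:E =
  (1 - gf p i (fun l => 1 - w l))%:E.
Proof.
move=> bw; have bw' := box_compl bw.
have H : (gf p i (fun l => 1 - w l)%R)%:E +
    \int[P]_x (1 - \prod_(l < i.+2) (1 - w l) ^+ X i x l)%:E = 1.
  rewrite -(gf_integral hxi 0 i 0 bw') -ge0_integralD//.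
  - transitivity (\int[P]_x cst 1 x).
      by apply: eq_integral => x _; rewrite -EFinD addrC subrK.
    by rewrite integral_cst// mul1e; exact: probability_setT.
  - by move=> x _; rewrite lee_fin; case/andP: (prodX_box i.+2 (X i x) bw').
  - exact: (mX _ (fun r => \prod_(l < i.+2) (1 - w l) ^+ r l)%R).
  - by move=> x _; rewrite lee_fin subr_ge0; case/andP: (prodX_box i.+2 (X i x) bw').
  - exact: (mX _ (fun r => 1 - \prod_(l < i.+2) (1 - w l) ^+ r l)%R).
move: H; case: (\int[P]_x _) => [r| |] //=; rewrite -EFinD => -[H].
by congr EFin; apply: (addrI (gf p i (fun l => 1 - w l)%R)); rewrite H addrC subrK.
Qed.

(* The offspring contains two distinct individuals, one of type [a] and one of
   type [b]; the types may coincide. *)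
Definition pair_event (a b : nat) : set (nat -> nat) :=
  [set r | (0 < r a)%N /\ ((a == b) < r b)%N].

(** The expectation of [prod_pair_ge] on the pair event and of the first Bonferroni inequality off
    it. The extra term later excludes pairs, or drives the growth of the survival ratio. *)
Lemma gf_upper i (w : nat -> R) a b : box w -> (a < i.+2)%N -> (b < i.+2)%N ->
  (1 - gf p i (fun l => 1 - w l))%:E + P (X i @^-1` pair_event a b) * (w a * w b)%:E
  <= \sum_(l < i.+2) M i l * (w l)%:E.
Proof.
move=> bw ai bi; have bw' := box_compl bw.
have w0 l : (0 <= w l)%R by case/andP: (bw l).
pose F (r : nat -> nat) : R := ((\1_(pair_event a b) r : R) * (w a * w b))%R.
have mP : measurable (X i @^-1` pair_event a b) by exact: (dmeas_xi hxi).
rewrite -mean_linear// -gf_compl//.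
have -> : P (X i @^-1` pair_event a b) * (w a * w b)%:E = \int[P]_x (F (X i x))%:E.
  rewrite -[Y in P Y * _]setIT -integral_indic// muleC -ge0_integralZl_EFin//.
  - by apply: eq_integral => x _; rewrite -EFinM mulrC /F !indicE.
  - exact/measurable_EFinP.
  - exact: mulr_ge0.
rewrite -ge0_integralD//.
- apply: ge0_le_integral => //.
  + move=> x _; rewrite lee_fin addr_ge0//.
      by rewrite subr_ge0; case/andP: (prodX_box i.+2 (X i x) bw').
    by rewrite /F indicE !mulr_ge0.
  + exact: (mX _ (fun r => (1 - \prod_(l < i.+2) (1 - w l) ^+ r l) + F r)%R).
  + exact: (mX _ (fun r => \sum_(l < i.+2) (r l)%:R * w l)%R).
  + move=> x _; rewrite lee_fin /F indicE.
    have [inP|notP] := pselect (pair_event a b (X i x)).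
      rewrite mem_set// mul1r; case: inP => ra rb.
      by have := prod_pair_ge bw ai bi ra rb; lra.
    rewrite memNset// mul0r addr0.
    by have [_ _ _ h _] := bonferroni_prod i.+2 (X i x) bw; lra.
- by move=> x _; rewrite lee_fin subr_ge0; case/andP: (prodX_box i.+2 (X i x) bw').
- exact: (mX _ (fun r => 1 - \prod_(l < i.+2) (1 - w l) ^+ r l)%R).
- by move=> x _; rewrite lee_fin /F indicE !mulr_ge0.
Qed.

(** The expectation of the second Bonferroni inequality, with the pair sum rewritten by
    [quad_form]. *)
Lemma gf_lower i (w : nat -> R) : box w ->
  \sum_(l < i.+2) M i l * (w l)%:E <=
  (1 - gf p i (fun l => 1 - w l))%:E +
  \sum_(k < i.+2) \sum_(l < i.+2)
     (\int[P]_x ((X i x l * (X i x k - (k == l :> nat)))%:R)%:E) * (w k * w l / 2)%:E.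
Proof.
move=> bw; have bw' := box_compl bw.
have w0 l : (0 <= w l)%R by case/andP: (bw l).
rewrite -mean_linear// -gf_compl//.
pose F k (r : nat -> nat) : R :=
  (\sum_(l < i.+2) (r l * (r k - (k == l :> nat)))%:R * (w k * w l / 2))%R.
have F0 k r : (0 <= F k r)%R.
  by apply: sumr_ge0 => l _; rewrite !mulr_ge0// invr_ge0.
have -> : \sum_(k < i.+2) \sum_(l < i.+2)
     (\int[P]_x ((X i x l * (X i x k - (k == l :> nat)))%:R)%:E) * (w k * w l / 2)%:E =
     \int[P]_x (\sum_(k < i.+2) F k (X i x))%:E.
  under [RHS]eq_integral do rewrite -sumEFin.
  rewrite ge0_integral_sum//.
  - apply: eq_bigr => k _.
    rewrite (integral_linear i i.+2 (fun r l => r l * (r k - (k == l :> nat)))%N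
      (y := fun l => (w k * w l / 2)%R))//.
    by move=> l; rewrite !mulr_ge0.
  - by move=> k x _; rewrite lee_fin.
rewrite -ge0_integralD//.
- apply: ge0_le_integral => //.
  + by move=> x _; rewrite lee_fin; apply: sumr_ge0 => l _; rewrite mulr_ge0.
  + exact: (mX _ (fun r => \sum_(l < i.+2) (r l)%:R * w l)%R).
  + exact: (mX _ (fun r => (1 - \prod_(l < i.+2) (1 - w l) ^+ r l) + \sum_(k < i.+2) F k r)%R).
  + move=> x _; rewrite lee_fin.
    have [_ _ _ _ h] := bonferroni_prod i.+2 (X i x) bw.
    rewrite quad_form in h.
    rewrite (_ : \sum_(k < i.+2) F k (X i x) = (\sum_(k < i.+2) \sum_(j < i.+2)
       (X i x j * (X i x k - (k == j)))%:R * (w k * w j)) / 2)%R; first by lra.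
    rewrite mulr_suml; apply: eq_bigr => k _; rewrite mulr_suml; apply: eq_bigr => l _.
    by rewrite !mulrA.
- by move=> x _; rewrite lee_fin subr_ge0; case/andP: (prodX_box i.+2 (X i x) bw').
- exact: (mX _ (fun r => 1 - \prod_(l < i.+2) (1 - w l) ^+ r l)%R).
- by move=> x _; rewrite lee_fin; apply: sumr_ge0.
- exact: (mX _ (fun r => \sum_(k < i.+2) F k r)%R).
Qed.

End Moments.


(** * Supercritical truncations *)

Lemma small_uniform (R : realType) (Q : nat -> R -> Prop) K :
  (forall a, (a <= K)%N -> exists2 e0 : R, (0 < e0)%R & forall e, (0 < e <= e0)%R -> Q a e) ->
  exists2 e0 : R, (0 < e0)%R & forall e, (0 < e <= e0)%R -> forall a, (a <= K)%N -> Q a e.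
Proof.
elim: K => [|K IHK] QK.
  have [e0 e00 h] := QK 0%N (leqnn 0); exists e0 => // e /h Q0 a.
  by rewrite leqn0 => /eqP ->.
have [e0 e00 h] := IHK (fun a aK => QK a (leqW aK)).
have [e1 e10 h1] := QK K.+1 (leqnn _).
exists (Num.min e0 e1); first by rewrite lt_min e00.
move=> e /andP[e_gt0]; rewrite le_min => /andP[ee0 ee1] a.
rewrite leq_eqVlt => /predU1P[->|]; first by apply: h1; rewrite e_gt0.
by rewrite ltnS => aK; apply: h => //; rewrite e_gt0.
Qed.

Section Survival.
Context (d : measure_display) (T : measurableType d) (R : realType).
Variables (P : probability T R) (p : nat -> (nat -> nat) -> R).
Variable xi : nat * nat * nat -> T -> nat -> nat.
Hypothesis hxi : offspring_family P p xi.

Local Notation X i := (xi (0%N, i, 0%N)).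
Local Notation M := (mean p).

Let mX i (F : (nat -> nat) -> R) D : measurable_fun D (fun w => (F (X i w))%:E).
Proof. exact: (measurable_xi_EFin hxi). Qed.

(* The offspring numbers are truncated at [B], so as to have finite second moments. *)
Lemma gf_strict i (y : nat -> R) (c : R) : (forall l, 0 <= y l)%R ->
  c%:E < \sum_(l < i.+2) M i l * (y l)%:E ->
  exists2 e0 : R, (0 < e0)%R & forall e, (0 < e <= e0)%R -> box (fun l => e * y l)%R ->
    (e * c <= 1 - gf p i (fun l => 1 - e * y l))%R.
Proof.
move=> y0 hc.
pose g B (r : nat -> nat) : R := (\sum_(l < i.+2) (minn (r l) B)%:R * y l)%R.
have g0 B r : (0 <= g B r)%R by apply: sumr_ge0 => l _; rewrite mulr_ge0.
have [B hB] : exists B, c%:E < \int[P]_w (g B (X i w))%:E.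
  apply: contrapT => /forallNP hn; move: hc; apply/negP; rewrite -leNgt.
  rewrite -(mean_linear hxi)//.
  have cv : \int[P]_w (g B (X i w))%:E @[B --> \oo] -->
     \int[P]_w (\sum_(l < i.+2) (X i w l)%:R * y l)%:E.
    have -> : \int[P]_w (\sum_(l < i.+2) (X i w l)%:R * y l)%:E =
        \int[P]_w (lim ((g B (X i w))%:E @[B --> \oo])).
      apply: eq_integral => w _; apply/esym/cvg_lim => //.
      apply: cvg_near_cst; exists (\max_(l < i.+2) X i w l)%N => // B /= hB.
      congr EFin; apply: eq_bigr => l _; congr (_%:R * _)%R; apply/minn_idPl.
      by apply: leq_trans hB; exact: (leq_bigmax l).
    apply: cvg_monotone_convergence => //.
    - by move=> B w _; rewrite lee_fin.
    - move=> w _ B B' BB'; rewrite lee_fin; apply: ler_sum => l _.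
      by apply: ler_wpM2r => //; rewrite ler_nat leq_min geq_minl geq_min BB' orbT.
  rewrite -(cvg_lim _ cv)//; apply: lime_le; first exact: (cvgP _ cv).
  by apply: nearW => B; rewrite leNgt; apply/negP/hn.
pose K : R := (B%:R * \sum_(l < i.+2) y l)%R.
have K0 : (0 <= K)%R by rewrite mulr_ge0// sumr_ge0.
have gK r : (g B r <= K)%R.
  rewrite /K mulr_sumr; apply: ler_sum => l _; apply: ler_wpM2r => //.
  by rewrite ler_nat geq_minr.
have gfin : \int[P]_w (g B (X i w))%:E \is a fin_num.
  rewrite ge0_fin_numE; last by apply: integral_ge0 => w _; rewrite lee_fin.
  apply: (@le_lt_trans _ _ (\int[P]_w cst K%:E w)).
    apply: ge0_le_integral => //; first by move=> w _; rewrite lee_fin.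
    by move=> w _; rewrite lee_fin.
  by rewrite integral_cst// [Y in _ * Y]probability_setT mule1 ltry.
pose I := fine (\int[P]_w (g B (X i w))%:E).
have IE : \int[P]_w (g B (X i w))%:E = I%:E by rewrite fineK.
have cI : (c < I)%R by rewrite -lte_fin -IE.
have I0 : (0 <= I)%R by rewrite -lee_fin -IE; apply: integral_ge0 => w _; rewrite lee_fin.
have D0 : (0 < K * I + 1)%R by rewrite ltr_wpDl// mulr_ge0.
(* For [e] up to this threshold [e * (K * I + 1) <= I - c], hence [(1 - e * K / 2) * I >= c]; the
   added 1 keeps the denominator positive. *)
exists ((I - c) / (K * I + 1))%R; first by rewrite divr_gt0// subr_gt0.
move=> e /andP[e0 eI] bey.
(* Second Bonferroni inequality for the truncated offspring, whose quadratic term is at most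
   [e ^+ 2 * K * g / 2] because [g <= K]. *)
have key : (e * (1 - e * K / 2) * I <= 1 - gf p i (fun l => 1 - e * y l))%R.
  rewrite -lee_fin -(gf_compl hxi)// EFinM -IE.
  have [Kn|Kn] := leP 0%R (1 - e * K / 2)%R; last first.
    apply: (@le_trans _ _ 0); last first.
      apply: integral_ge0 => w _; rewrite lee_fin subr_ge0.
      have := prodX_box i.+2 (X i w) (s := fun l => (1 - e * y l)%R).
      by case/(_ _)/andP => // l; have := bey l; lra.
    by rewrite IE -EFinM lee_fin mulr_le0_ge0// mulr_ge0_le0 ?(ltW e0) ?(ltW Kn)//.
  rewrite -ge0_integralZl_EFin//; first last.
  - by rewrite mulr_ge0// ltW.
  - by move=> w _; rewrite lee_fin.
  apply: ge0_le_integral => //.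
  - by move=> w _; rewrite -EFinM lee_fin !mulr_ge0// ltW.
  - exact: (mX _ (fun r => e * (1 - e * K / 2) * g B r)%R).
  - exact: (mX _ (fun r => 1 - \prod_(l < i.+2) (1 - e * y l) ^+ r l)%R).
  move=> w _; rewrite -EFinM lee_fin.
  have [_ _ VL _ h] := bonferroni_prod i.+2 (fun l => minn (X i w l) B) bey.
  have V0 : (0 <= \sum_(l < i.+2) (minn (X i w l) B)%:R * (e * y l) ^+ 2)%R.
    by apply: sumr_ge0 => l _; rewrite mulr_ge0// sqr_ge0.
  have gE : (\sum_(l < i.+2) (minn (X i w l) B)%:R * (e * y l) = e * g B (X i w))%R.
    by rewrite /g mulr_sumr; apply: eq_bigr => l _; rewrite mulrCA.
  rewrite gE in h.
  have pr : (\prod_(l < i.+2) (1 - e * y l) ^+ X i w l <=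
    \prod_(l < i.+2) (1 - e * y l) ^+ minn (X i w l) B)%R.
    apply: ler_prod => l _; have /andP[b0 b1] := bey l.
    by rewrite exprn_ge0 ?subr_ge0//= ler_wiXn2l ?subr_ge0 ?lerBlDr ?lerDl// geq_minl.
  move: (gK (X i w)) (g0 B (X i w)) h pr V0; set G := g B _; set q := (\prod_(_ < _) _)%R.
  set q' := (\prod_(_ < _) _)%R; set V := (\sum_(_ < _) _)%R => GK G0 h pr V0.
  have : (0 <= e * e * (G * (K - G)))%R by rewrite !mulr_ge0// ?subr_ge0// ltW.
  nra.
apply: le_trans key; rewrite -mulrA ler_pM2l//.
have : (e * (K * I + 1) <= I - c)%R by rewrite -ler_pdivlMr.
have : (0 <= e * (K * I))%R by apply: mulr_ge0; [exact: ltW|exact: mulr_ge0].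
lra.
Qed.

(** [gf_strict] is applied to the indicator of [b]: for small [e], [s] lies below [1 - e * y]. *)
Lemma gf_lt1 a b (s : nat -> R) : box s -> (s b < 1)%R -> 0 < M a b ->
  (gf p a s < 1)%R.
Proof.
move=> bs sb Mab.
have ab : (b < a.+2)%N.
  by rewrite ltnNge; apply/negP => ab; move: Mab; rewrite (mean_out hxi)// ltxx.
pose y l : R := (l == b)%:R%R.
have y0 l : (0 <= y l)%R by rewrite /y.
have SM : \sum_(l < a.+2) M a l * (y l)%:E = M a b.
  rewrite (bigD1 (Ordinal ab))//= /y eqxx mule1 big1 ?adde0// => l.
  by rewrite -val_eqE /= => /negPf ->; rewrite mule0.
have [c c0 cM] : exists2 c : R, (0 < c)%R & c%:E < M a b.
  move: Mab; case: (M a b) => [r| |]// r0.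
    by exists (r / 2)%R; [rewrite divr_gt0|rewrite lte_fin ltr_pdivrMr// ltr_pMr// ltr1n].
  by exists 1%R => //; rewrite ltry.
rewrite -SM in cM; have [e0 e00 h] := gf_strict y0 cM.
pose e := Num.min e0 (1 - s b)%R.
have /andP[sb0 _] := bs b.
have e_gt0 : (0 < e)%R by rewrite lt_min e00 subr_gt0.
have ee0 : (e <= e0)%R by rewrite ge_min lexx.
have es : (e <= 1 - s b)%R by rewrite ge_min lexx orbT.
have bey : box (fun l => e * y l)%R.
  by move=> l; rewrite /y; case: eqP => _; rewrite ?mulr1 ?mulr0 ?lexx ?ler01//; lra.
have := h e; rewrite e_gt0 ee0 => /(_ isT bey) hc.
have : (gf p a s <= gf p a (fun l => 1 - e * y l))%R.
  apply: (gf_le hxi) => //; first by move=> l; have := bey l; lra.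
  move=> l _; have := bs l; rewrite /y; case: eqP => [->|_]; rewrite ?mulr1 ?mulr0; lra.
have : (0 < e * c)%R by rewrite mulr_gt0.
lra.
Qed.

Lemma gfiter_le_sub N s (t : nat -> R) : box s -> box t -> (forall i, s i <= t i)%R ->
  (forall i, gf p i t <= t i)%R -> forall i, (gfiter p N s i <= t i)%R.
Proof.
move=> bs bt st gt; elim: N => [|N IHN] i //=.
apply: le_trans (gt i); apply: (gf_le hxi) => //; exact: (gfiter_box hxi).
Qed.

Lemma avoid_dec l m m' i : (m <= m')%N -> (avoid p l m' i <= avoid p l m i)%R.
Proof.
have step : forall m i, (avoid p l m.+1 i <= avoid p l m i)%R.
  elim=> [|k IHk] j.
    have /andP[_ g1] := gf_box hxi (box_ne R l) j.
    by rewrite /avoid /= ler_piMr.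
  rewrite /avoid /= -/(avoid p l k); apply: ler_wpM2l => //.
  apply: (gf_le hxi) => [||l' _]; [exact: (avoid_box hxi l k.+1)|exact: (avoid_box hxi l k)|exact: IHk].
elim: m' => [|m' IH]; first by rewrite leqn0 => /eqP ->.
by rewrite leq_eqVlt => /predU1P[->//|]; rewrite ltnS => /IH; apply: le_trans; exact: step.
Qed.

(** Strict inequality propagates backwards along the path by [gf_lt1], one generation per edge. *)
Lemma avoid_lt1 l a (s : seq nat) : path (fun x y => 0 < M x y) a s ->
  last a s = l -> exists m, (avoid p l m a < 1)%R.
Proof.
elim: s a => [|b s IHs] a /=; first by move=> _ ->; exists 0%N; rewrite /= eqxx ltr01.
move=> /andP[Mab pb] /(IHs b pb)[m hm]; exists m.+1 => /=.
have gl := gf_lt1 (avoid_box hxi l m) hm Mab.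
by case: eqP => _; rewrite ?mul0r ?ltr01// mul1r.
Qed.

Lemma avoid_lt1_unif l K : irreducible_law p ->
  exists m, forall a, (a <= K)%N -> (avoid p l m a < 1)%R.
Proof.
move=> hirr; elim: K => [|K [m IHm]].
  have [s [ps ls]] := hirr 0%N l; have [m hm] := avoid_lt1 ps ls.
  by exists m => a; rewrite leqn0 => /eqP ->.
have [s [ps ls]] := hirr K.+1 l; have [m' hm'] := avoid_lt1 ps ls.
exists (maxn m m') => a; rewrite leq_eqVlt => /predU1P[->|].
  by apply: le_lt_trans hm'; apply: avoid_dec; exact: leq_maxr.
by rewrite ltnS => /IHm; apply: le_lt_trans; apply: avoid_dec; exact: leq_maxl.
Qed.

(** For small [e0], [t = 1 - e0 * y] lies above [avoid p 0 m] and is a supersolution, both trivially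
    beyond [K]. Hence it lies above all iterates of [avoid p 0 m'] for [m' >= m], and from type 0
    the probability that type 0 is eventually absent is at most [t 0 < 1]. *)
Lemma survive_finite K (y : nat -> R) : irreducible_law p ->
  (forall a, (a <= K)%N -> 0 < y a)%R -> (forall a, (K < a)%N -> y a = 0%R) ->
  (forall a, (a <= K)%N -> (y a)%:E < \sum_(l < a.+2) M a l * (y l)%:E) ->
  q_local P xi 0 <> 1.
Proof.
move=> hirr yK y0 hy.
have y_ge0 l : (0 <= y l)%R by have [/yK/ltW|/y0 ->] := leqP l K.
have [m hm] := avoid_lt1_unif 0 K hirr.
have [e0 e00 he0] : exists2 e0 : R, (0 < e0)%R & forall e, (0 < e <= e0)%R ->
   forall a, (a <= K)%N -> (e * y a <= 1 - avoid p 0 m a)%R /\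
   (box (fun l => e * y l)%R -> (e * y a <= 1 - gf p a (fun l => 1 - e * y l))%R).
  apply: small_uniform => a aK.
  have [e1 e10 h1] := gf_strict y_ge0 (hy a aK).
  exists (Num.min e1 ((1 - avoid p 0 m a) / y a)%R).
    by rewrite lt_min e10/= divr_gt0 ?yK// subr_gt0 hm.
  move=> e /andP[e_gt0]; rewrite le_min => /andP[ee1 ee2]; split.
    by rewrite -ler_pdivlMr// yK.
  by apply: h1; rewrite e_gt0.
have /he0 h : (0 < e0 <= e0)%R by rewrite e00 lexx.
have bey : box (fun l => e0 * y l)%R.
  move=> l; rewrite mulr_ge0 ?(ltW e00)//=; have [lK|lK] := leqP l K.
    by have [h1 _] := h l lK; apply: le_trans h1 _; rewrite lerBlDr lerDl; case/andP: (avoid_box hxi 0 m l).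
  by rewrite y0// mulr0 ler01.
pose t l := (1 - e0 * y l)%R.
have bt : box t by move=> l; have := bey l; rewrite /t; lra.
have gt i : (gf p i t <= t i)%R.
  have [iK|iK] := leqP i K; first by have [_ /(_ bey)] := h i iK; rewrite /t; lra.
  by rewrite {2}/t y0// mulr0 subr0; case/andP: (gf_box hxi bt i).
have at_le m' i : (m <= m')%N -> (avoid p 0 m' i <= t i)%R.
  move=> mm'; apply: le_trans (avoid_dec 0 i mm') _.
  have [iK|iK] := leqP i K; first by have [+ _] := h i iK; rewrite /t; lra.
  by rewrite /t y0// mulr0 subr0; case/andP: (avoid_box hxi 0 m i).
have [V [W [VN WN ->]]] := q_localE hxi 0.
move=> /(_ 0%N) W1; have V_le N : (V 0%N N <= t 0%N)%R.
  rewrite -(cvg_lim _ (VN 0%N N))//; apply: limr_le; first exact: (cvgP _ (VN 0%N N)).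
  exists m => // m' /= mm'; apply: gfiter_le_sub => //; first exact: (avoid_box hxi).
  by move=> i; exact: at_le.
have : (W 0%N <= t 0%N)%R.
  rewrite -(cvg_lim _ (WN 0%N))//; apply: limr_le; first exact: (cvgP _ (WN 0%N)).
  exact: nearW.
by rewrite W1 /t; have := mulr_gt0 e00 (yK 0%N (leq0n K)); lra.
Qed.

End Survival.


Lemma le_sum_term (R : realType) n (F : nat -> \bar R) k :
  (forall l, 0 <= F l) -> (k < n)%N -> F k <= \sum_(l < n) F l.
Proof.
by move=> F0 kn; rewrite (bigD1 (Ordinal kn))//= leeDl// sume_ge0.
Qed.

(** * The recursion for [mu] and the eigenvector [xvec] *)

Section Recursion.
Variables (R : realType) (p : nat -> (nat -> nat) -> R).
Local Notation M := (mean p).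
Local Notation mu := (lh_mu p).
Hypotheses (M0 : forall i j, 0 <= M i j) (hM : forall i, 0 < M i i.+1).

(* [xvec] is the right eigenvector of the mean matrix for the eigenvalue 1. *)
Definition xvec (i : nat) : R := (\prod_(0 <= j < i) fine (mu j))^-1%R.

Definition mu_ok k := 0 < mu k < +oo.

Lemma mu_okE k : mu_ok k -> exists2 r : R, (0 < r)%R & mu k = r%:E.
Proof.
rewrite /mu_ok; case: (mu k) => [r|/andP[]|/andP[]]// /andP[r0 _].
by exists r; rewrite -?lte_fin.
Qed.

Lemma xvec_gt0 k i : (forall j, (j < k)%N -> mu_ok j) -> (i <= k)%N -> (0 < xvec i)%R.
Proof.
move=> ok ik; rewrite /xvec invr_gt0 big_mkord; apply: prodr_gt0 => j _.
by have [r r0 ->] := mu_okE (ok j (leq_trans (ltn_ord j) ik)).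
Qed.

Lemma xvec0 : xvec 0 = 1%R.
Proof. by rewrite /xvec big_nil invr1. Qed.

Lemma xvecS k : xvec k.+1 = (xvec k / fine (mu k))%R.
Proof. by rewrite /xvec big_nat_recr//= invfM. Qed.

Lemma mprodE k i : (forall j, (j < k)%N -> mu_ok j) -> (i <= k)%N ->
  mprod mu i k = (xvec i / xvec k)%:E.
Proof.
move=> ok ik; have xi0 := xvec_gt0 ok ik.
rewrite {2}/xvec invrK (big_cat_nat _ ik)//= mulrA.
rewrite (_ : _ * \prod_(0 <= j < i) _ = 1)%R ?mul1r; last first.
  by rewrite mulVf// -invr_eq0 gt_eqF.
rewrite /mprod -prodEFin; apply: eq_big_nat => j /andP[_ jk].
by have [r r0 ->] := mu_okE (ok j jk).
Qed.

Definition mean_row k := \sum_(l < k.+1) M k l * (xvec l / xvec k)%:E.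

Lemma mu_row k : (forall j, (j < k)%N -> mu_ok j) -> mu k = M k k.+1 / (1 - mean_row k).
Proof.
move=> ok; rewrite lh_muE; congr (_ / (_ - _)); rewrite big_mkord /mean_row.
by apply: eq_bigr => l _; rewrite (mprodE ok)// -ltnS.
Qed.

Lemma mean_row_ge0 k : (forall j, (j < k)%N -> mu_ok j) -> 0 <= mean_row k.
Proof.
move=> ok; apply: sume_ge0 => l _; rewrite mule_ge0// lee_fin.
by rewrite divr_ge0// ltW// (xvec_gt0 ok)// -ltnS.
Qed.

(** A zero denominator inverts to [+oo], and a negative one, possibly [-oo], makes [mu] negative.
    Only a positive denominator with a finite numerator remains. *)
Lemma mu_okP k : (forall j, (j < k)%N -> mu_ok j) ->
  mu_ok k <-> mean_row k < 1 /\ M k k.+1 < +oo.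
Proof.
move=> ok; rewrite /mu_ok (mu_row ok).
have := mean_row_ge0 ok; have := hM k.
case: (mean_row k) => [s| |] //; case: (M k k.+1) => [m| |] //; last first.
- by move=> _ _; rewrite addeNy inveNy mulyNy; split => [/andP[]|[]].
- move=> m0 _; rewrite addeNy inveNy mulrNy gtr0_sg// ?mul1e; first by split => [/andP[]|[]].
- move=> _ s0; split => [|[]//].
  rewrite -EFinB inver; case: eqP => [_|_]; first by rewrite mulyy ltxx andbF.
  by rewrite mulyr; case: sgrP => _; rewrite ?mul0e ?ltxx//= ?mul1e ?ltxx ?andbF// mulN1e.
- rewrite !lte_fin => m0 s0; rewrite -EFinB inver; case: eqP => [h|/eqP h].
    rewrite mulry gtr0_sg// mul1e ltxx andbF; split => // -[s1].
    by move: s1; rewrite -subr_gt0 h ltxx.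
  rewrite -EFinM lte_fin !ltry andbT pmulr_rgt0// invr_gt0 subr_gt0.
  by split => [|[]].
Qed.

(** For [l <= k], a positive multiple of [M k l] is a term of [mean_row k < 1]; the entry at [k.+1]
    is covered by [mu_okP]. *)
Lemma mean_fin k l : (forall j, (j <= k)%N -> mu_ok j) -> (l <= k.+1)%N ->
  M k l \is a fin_num.
Proof.
move=> ok lk; have ok' j : (j < k)%N -> mu_ok j by move=> /ltnW /ok.
have [/[swap] fk Sk] := (mu_okP ok').1 (ok k (leqnn k)).
rewrite (ge0_fin_numE (M0 k l)); move: lk; rewrite leq_eqVlt => /predU1P[->|lk].
  exact: fk.
have xlk : (0 < xvec l / xvec k)%R.
  by rewrite divr_gt0// (xvec_gt0 ok')// -ltnS.
have : M k l * (xvec l / xvec k)%:E < +oo.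
  apply: le_lt_trans (lt_trans Sk (ltry 1)).
  rewrite /mean_row (bigD1 (Ordinal lk))//= leeDl//; apply: sume_ge0 => i _.
  by rewrite mule_ge0// lee_fin divr_ge0// ltW// (xvec_gt0 ok')// -ltnS.
have := M0 k l; case: (M k l) => [r _ _|_|]//; first exact: ltry.
by rewrite mulyr gtr0_sg// mul1e.
Qed.

(** As [x_(k+1) = x_k / mu_k], the recursion multiplied out reads [M k k.+1 * x_(k+1) = (1 -
    mean_row k) * x_k]. *)
Lemma mean_xvec k : (forall j, (j <= k)%N -> mu_ok j) ->
  \sum_(l < k.+2) M k l * (xvec l)%:E = (xvec k)%:E.
Proof.
move=> ok; have ok' j : (j < k)%N -> mu_ok j by move=> /ltnW /ok.
have [r r0 mur] := mu_okE (ok k (leqnn k)).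
have xk0 := xvec_gt0 ok' (leqnn k).
have MkE l : (l <= k.+1)%N -> M k l = (fine (M k l))%:E.
  by move=> lk; rewrite fineK// mean_fin.
have [Sk _] := (mu_okP ok').1 (ok k (leqnn k)).
pose S := (\sum_(l < k.+1) fine (M k l) * (xvec l / xvec k))%R.
have SE : mean_row k = S%:E.
  rewrite /mean_row /S -sumEFin; apply: eq_bigr => l _; rewrite MkE//.
  by rewrite ltnW// ltnS -ltnS.
rewrite big_ord_recr /= MkE// xvecS mur /=.
have /eqP := mu_row ok'; rewrite mur SE MkE// -EFinB inver.
rewrite SE lte_fin -subr_gt0 in Sk; rewrite (gt_eqF Sk) -EFinM eqe => /eqP rE.
rewrite (_ : \sum_(l < k.+1) _ = (S * xvec k)%:E).
  rewrite -EFinM -EFinD rE; congr EFin; field.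
  have m0 : fine (M k k.+1) != 0%R by rewrite gt_eqF// -lte_fin -MkE.
  by rewrite m0 gt_eqF.
rewrite /S mulr_suml -sumEFin; apply: eq_bigr => l _; rewrite MkE; last first.
  by rewrite ltnW// ltnS -ltnS.
by rewrite -EFinM; congr EFin; field; rewrite gt_eqF.
Qed.

Lemma sub_mean k : exists2 c : R, (0 < c)%R & (c%:E <= M k k.+1) /\ (c <= 1)%R.
Proof.
have := hM k; case: (M k k.+1) => [r| |] // r0.
  exists (Num.min 1 r)%R; first by rewrite lt_min ltr01.
  by rewrite lee_fin !ge_min !lexx orbT.
by exists 1%R => //; rewrite leey.
Qed.

(** Takes the first edge by which the path enters the types up to [k]. *)
Lemma path_crossing k a (s : seq nat) : (k < a)%N ->
  path (fun x y => 0 < M x y) a s -> last a s = 0%N ->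
  exists K j, [/\ (k < K)%N, (j <= k)%N & 0 < M K j].
Proof.
elim: s a => [|b s IHs] a /= ka; first by move=> _ a0; rewrite a0 in ka.
move=> /andP[Mab pb] lb; have [kb|bk] := ltnP k b; first exact: IHs kb pb lb.
by exists a, b.
Qed.

(* If [mu_k] fails to be positive and finite, then a perturbation of
   [(x_0, ..., x_k, 0, ...)] witnesses that a finite truncation is supercritical. *)
Lemma supercritical_vector k : irreducible_law p ->
  (forall j, (j < k)%N -> mu_ok j) -> ~ mu_ok k ->
  exists (K : nat) (y : nat -> R),
  [/\ (forall a, (a <= K)%N -> 0 < y a)%R, (forall a, (K < a)%N -> y a = 0%R) &
  (forall a, (a <= K)%N -> (y a)%:E < \sum_(l < a.+2) M a l * (y l)%:E)].
Proof.
move=> hirr ok nok.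
have [s [ps ls]] := hirr k.+1 0%N.
have [K [j0 [kK j0k MK]]] := path_crossing (ltnSn k) ps ls.
have /choice[cc hcc] : forall a, exists c : R,
    [/\ (0 < c)%R, c%:E <= M a a.+1 & (c <= 1)%R].
  by move=> a; have [c c0 [c1 c2]] := sub_mean a; exists c.
have xj0 : (0 < xvec j0)%R by exact: xvec_gt0 ok j0k.
(* The return edge from [K] to [j0] yields more than [dK] at [K] out of the unperturbed vector
   alone. *)
have [dK dK0 dKM] : exists2 dK : R, (0 < dK)%R & dK%:E < M K j0 * (xvec j0)%:E.
  move: MK; case: (M K j0) => [r| |] // r0.
    exists (r * xvec j0 / 2)%R; first by rewrite divr_gt0// mulr_gt0.
    by rewrite -EFinM lte_fin ltr_pdivrMr// ltr_pMr ?ltr1n// mulr_gt0.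
  by exists 1%R => //; rewrite mulyr gtr0_sg// mul1e ltry.
(* The weights are chosen backwards from [K] so that the single step from [a] to [a.+1] already
   yields at least [2 * del a]. *)
pose del a : R := (dK * \prod_(a <= b < K) (cc b / 2))%R.
have del_gt0 a : (0 < del a)%R.
  rewrite mulr_gt0//; elim/big_ind : _ => // [x y|b _]; first exact: mulr_gt0.
  by have [c0 _ _] := hcc b; rewrite divr_gt0.
have delS a : (a < K)%N -> (del a * 2 = cc a * del a.+1)%R.
  by move=> aK; rewrite /del big_ltn//; field.
have delK : del K = dK by rewrite /del big_geq// mulr1.
pose u a : R := if (a <= k)%N then xvec a else 0%R.
pose v a : R := if (a <= K)%N then del a else 0%R.
have u0 a : (0 <= u a)%R by rewrite /u; case: ifP => // ak; rewrite ltW// (xvec_gt0 ok).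
have v0 a : (0 <= v a)%R by rewrite /v; case: ifP => // _; exact: ltW.
have split_sum a : \sum_(l < a.+2) M a l * (u l + v l)%:E =
    \sum_(l < a.+2) M a l * (u l)%:E + \sum_(l < a.+2) M a l * (v l)%:E.
  rewrite -big_split /=; apply: eq_bigr => l _; rewrite EFinD ge0_muleDr// lee_fin//.
have su0 a : 0 <= \sum_(l < a.+2) M a l * (u l)%:E.
  by apply: sume_ge0 => l _; rewrite mule_ge0// lee_fin.
have sv0 a : 0 <= \sum_(l < a.+2) M a l * (v l)%:E.
  by apply: sume_ge0 => l _; rewrite mule_ge0// lee_fin.
have vstep a : M a a.+1 * (v a.+1)%:E <= \sum_(l < a.+2) M a l * (v l)%:E.
  apply: (le_sum_term (F := fun l => M a l * (v l)%:E)) => // l.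
  by rewrite mule_ge0// lee_fin.
have vlow a : (a < K)%N -> (del a * 2)%:E <= \sum_(l < a.+2) M a l * (v l)%:E.
  move=> aK; apply: le_trans (vstep a); rewrite delS// EFinM /v aK.
  by apply: lee_wpmul2r; [rewrite lee_fin ltW|have [_ + _] := hcc a].
have del2 a : (del a < del a * 2)%R by rewrite ltr_pMr// ltr1n.
exists K, (fun a => u a + v a)%R; split.
- by move=> a aK; rewrite ltr_wpDl// /v aK.
- by move=> a aK; rewrite /u /v leqNgt (ltn_trans kK aK) leqNgt aK addr0.
(* Below [k] the vector [u] is invariant and [v] gains strictly. Above [k], [u] vanishes at [a], and
   the gain comes from [v], or at [K] from the return edge. The case [a = k] comes last. *)
move=> a aK; rewrite split_sum; have [ak|ka|ak] := ltngtP a k.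
- have -> : \sum_(l < a.+2) M a l * (u l)%:E = (xvec a)%:E.
    rewrite -mean_xvec; last by move=> j ja; apply: ok; exact: leq_ltn_trans ak.
    apply: eq_bigr => l _; rewrite /u (_ : (l <= k)%N)//.
    by apply: leq_trans ak; rewrite -ltnS.
  rewrite /u /v aK (ltnW ak) EFinD lteD2lE//.
  by apply: lt_le_trans (vlow a (ltn_trans ak kK)); rewrite lte_fin.
- have {1}-> : u a = 0%R by rewrite /u leqNgt ka.
  rewrite add0r /v aK; move: aK; rewrite leq_eqVlt => /predU1P[->|aK].
    apply: (@lt_le_trans _ _ (M K j0 * (xvec j0)%:E)); first by rewrite delK.
    apply: (@le_trans _ _ (\sum_(l < K.+2) M K l * (u l)%:E)); last by rewrite leeDl.
    have -> : xvec j0 = u j0 by rewrite /u j0k.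
    apply: (le_sum_term (F := fun l => M K l * (u l)%:E)).
      by move=> l; rewrite mule_ge0// lee_fin.
    by rewrite (leq_ltn_trans j0k)// (ltn_trans kK).
  apply: (@lt_le_trans _ _ (del a * 2)%:E); first by rewrite lte_fin.
  by apply: (le_trans (vlow a aK)); rewrite leeDr.
subst a; rewrite {1}/u leqnn {1}/v (ltnW kK).
(* At [k], either [M k k.+1] is infinite, and so is the sum, or [mean_row k >= 1], and [u <= M u]
   holds at [k] although [u k.+1 = 0]. *)
have [Mky|Mkfin] := eqVneq (M k k.+1) +oo.
  have vk : (0 < v k.+1)%R by rewrite /v kK.
  suff -> : \sum_(l < k.+2) M k l * (v l)%:E = +oo.
    by rewrite addey ?ltry// gt_eqF// (lt_le_trans _ (su0 k))// ltNy0.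
  by apply/eqP; rewrite -leye_eq (le_trans _ (vstep k))// Mky mulyr gtr0_sg// mul1e.
have S1 : 1 <= mean_row k.
  rewrite leNgt; apply/negP => S1; apply: nok; apply/(mu_okP ok); split => //.
  by rewrite ltey.
have xk0 := xvec_gt0 ok (leqnn k).
have su : (xvec k)%:E <= \sum_(l < k.+2) M k l * (u l)%:E.
  apply: (@le_trans _ _ (mean_row k * (xvec k)%:E)).
    by rewrite -[leLHS]mul1e lee_wpmul2r// lee_fin ltW.
  rewrite big_ord_recr /= {2}/u ltnn mule0 adde0 /mean_row ge0_sume_distrl; last first.
    by move=> l _; rewrite mule_ge0// lee_fin divr_ge0// ltW// (xvec_gt0 ok)// -ltnS.
  rewrite le_eqVlt; apply/orP; left; apply/eqP; apply: eq_bigr => l _.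
  by rewrite /u -ltnS ltn_ord -muleA -EFinM divfK// gt_eqF.
rewrite EFinD addeC [ltRHS]addeC; apply: lte_leD => //.
by apply: lt_le_trans (vlow k kK); rewrite lte_fin.
Qed.

End Recursion.


Lemma cvg_sum_ord (R : realType) n (F : nat -> nat -> R) (f : nat -> R) :
  (forall i, F m i @[m --> \oo] --> f i) ->
  (\sum_(i < n) F m i)%R @[m --> \oo] --> (\sum_(i < n) f i)%R.
Proof.
by move=> Ff; apply: cvg_big => [|i _]; [exact: add_continuous|exact: Ff].
Qed.

Lemma le_cvg (R : realType) (u v : nat -> R) (a b : R) :
  u n @[n --> \oo] --> a -> v n @[n --> \oo] --> b -> (forall n, u n <= v n)%R -> (a <= b)%R.
Proof.
move=> ua vb uv; rewrite -(cvg_lim _ ua)// -(cvg_lim _ vb)//.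
by apply: ler_lim; [exact: (cvgP _ ua)|exact: (cvgP _ vb)|exact: nearW].
Qed.

Lemma cvg_compl (R : realType) (u : nat -> R) (a : R) :
  u n @[n --> \oo] --> a -> (1 - u n)%R @[n --> \oo] --> (1 - a)%R.
Proof. by move=> ua; apply: cvgB => //; exact: cvg_cst. Qed.

Lemma sum_null_term (R : realType) n (m D : nat -> R) b :
  (forall j, 0 <= m j)%R -> (forall j, 0 <= D j)%R ->
  (\sum_(j < n) m j * D j <= 0)%R -> (b < n)%N -> (0 < m b)%R -> D b = 0%R.
Proof.
move=> m0 D0 S0 bn mb; apply/eqP; rewrite eq_le D0 andbT -(pmulr_rle0 _ mb).
apply: le_trans S0; rewrite (bigD1 (Ordinal bn))//= lerDl.
by apply: sumr_ge0 => j _; rewrite mulr_ge0.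
Qed.

Lemma vsize_pair i r : (1 < vsize i r)%N ->
  exists a b, [/\ (a < i.+2)%N, (b < i.+2)%N & pair_event a b r].
Proof.
rewrite /vsize => r2.
have [a ra] : exists a : 'I_i.+2, (0 < r a)%N.
  apply: contrapT => /forallNP h; move: r2; rewrite big1// => l _.
  by apply/eqP; rewrite -leqn0 leqNgt; apply/negP/h.
have [ra2|ra2] := ltnP 1 (r a).
  by exists a, a; rewrite /pair_event /= eqxx.
have [b /andP[ba rb]] : exists b : 'I_i.+2, (b != a) && (0 < r b)%N.
  apply: contrapT => /forallNP h; move: r2; rewrite (bigD1 a)//= big1 ?addn0; last first.
    move=> l la; apply/eqP; rewrite -leqn0 leqNgt; apply/negP => rl.
    by apply: (h l); rewrite la.
  by rewrite ltnNge ra2.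
exists a, b; split => //; split => //.
by rewrite eq_sym (_ : (b : nat) == a = false)//; apply/negbTE.
Qed.

(** * The mean matrix in the reals and second order bounds *)

Section FiniteMeans.
Context (d : measure_display) (T : measurableType d) (R : realType).
Variables (P : probability T R) (p : nat -> (nat -> nat) -> R).
Variable xi : nat * nat * nat -> T -> nat -> nat.
Hypothesis hxi : offspring_family P p xi.
Hypotheses (hM : forall i, 0 < mean p i i.+1) (ok : forall k, mu_ok p k).

Local Notation X i := (xi (0%N, i, 0%N)).
Local Notation x := (xvec p).

Let M0 := mean_ge0 hxi.

Definition rmean i j : R := fine (mean p i j).

Lemma rmeanE i j : mean p i j = (rmean i j)%:E.
Proof.
rewrite /rmean fineK//; have [ji|ij] := leqP j i.+1.
  by apply: (mean_fin M0 hM) => // k _; exact: ok.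
by rewrite (mean_out hxi)// fin_num0.
Qed.

Lemma rmean_ge0 i j : (0 <= rmean i j)%R.
Proof. by rewrite -lee_fin -rmeanE. Qed.

Lemma rmean_gt0 i j : (0 < rmean i j)%R = (0 < mean p i j).
Proof. by rewrite rmeanE lte_fin. Qed.

Lemma xvec_pos i : (0 < x i)%R.
Proof. by apply: (@xvec_gt0 _ _ i) => // j _; exact: ok. Qed.

Lemma rmean_xvec i : (\sum_(j < i.+2) rmean i j * x j = x i)%R.
Proof.
apply: EFin_inj; rewrite -(@mean_xvec _ _ M0 hM i); last by move=> j _; exact: ok.
by rewrite -sumEFin; apply: eq_bigr => j _; rewrite EFinM rmeanE.
Qed.

Definition pair_prob i a b : R := fine (P (X i @^-1` pair_event a b)).

Lemma pair_probE i a b : P (X i @^-1` pair_event a b) = (pair_prob i a b)%:E.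
Proof. by rewrite fineK// fin_num_measure//; exact: (dmeas_xi hxi). Qed.

Lemma pair_prob_ge0 i a b : (0 <= pair_prob i a b)%R.
Proof. by rewrite -lee_fin -pair_probE. Qed.

Lemma gf_compl_le i s a b : box s -> (a < i.+2)%N -> (b < i.+2)%N ->
  (1 - gf p i s + pair_prob i a b * ((1 - s a) * (1 - s b)) <=
   \sum_(j < i.+2) rmean i j * (1 - s j))%R.
Proof.
move=> bs ai bi; have bw : box (fun l => 1 - s l)%R by move=> l; have := bs l; lra.
have := gf_upper hxi bw ai bi; rewrite pair_probE -EFinM -EFinD.
rewrite (_ : (fun l => 1 - (1 - s l))%R = s); last by apply/funext => l; ring.
under eq_bigr do rewrite rmeanE -EFinM.
by rewrite sumEFin lee_fin.
Qed.

Lemma gf_compl_le_lin i s : box s -> (1 - gf p i s <= \sum_(j < i.+2) rmean i j * (1 - s j))%R.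
Proof.
move=> bs; apply: le_trans (gf_compl_le bs (ltn0Sn _) (ltn0Sn _)).
have h0 : (0 <= 1 - s 0%N)%R by have := bs 0%N; lra.
by rewrite lerDl !mulr_ge0// pair_prob_ge0.
Qed.

(** The limit is taken in the inequality [gf_compl_le], between finite sums and products, and not
    inside [gf]. *)
Lemma gf_compl_limit i a b (u v : nat -> nat -> R) (f g : nat -> R) :
  (forall n, box (u n)) -> (forall n, v n i = gf p i (u n)) ->
  (forall j, u n j @[n --> \oo] --> f j) -> v n i @[n --> \oo] --> g i ->
  (a < i.+2)%N -> (b < i.+2)%N ->
  (1 - g i + pair_prob i a b * ((1 - f a) * (1 - f b)) <=
   \sum_(j < i.+2) rmean i j * (1 - f j))%R.
Proof.
move=> bu vE uf vg ai bi.
have A1 : (1 - v n i + pair_prob i a b * ((1 - u n a) * (1 - u n b)))%R @[n --> \oo] -->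
    (1 - g i + pair_prob i a b * ((1 - f a) * (1 - f b)))%R.
  apply: cvgD; first exact: cvg_compl.
  apply: cvgM; first exact: cvg_cst.
  by apply: cvgM; exact: cvg_compl.
have fine_moment2 : (\sum_(j < i.+2) rmean i j * (1 - u n j))%R @[n --> \oo] -->
    (\sum_(j < i.+2) rmean i j * (1 - f j))%R.
  apply: (@cvg_sum_ord _ i.+2 ( fun n j => rmean i j * (1 - u n j))%R
     (fun j => rmean i j * (1 - f j))%R) => j.
  by apply: cvgM; [exact: cvg_cst|exact: cvg_compl].
apply: (le_cvg A1 fine_moment2) => n; rewrite vE; exact: gf_compl_le.
Qed.

(** Off the null event [N] there is at most one child, so the number of children is the indicator of
    having exactly one. *)
Lemma mean_sum_le i : (forall a b, (a < i.+2)%N -> (b < i.+2)%N -> pair_prob i a b = 0%R) ->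
  (\sum_(j < i.+2) rmean i j)%:E <= P (X i @^-1` [set r | vsize i r = 1%N]).
Proof.
move=> pp0; pose N := \bigcup_a \bigcup_b (X i @^-1` pair_event a b).
have mpe a b : measurable (X i @^-1` pair_event a b) by exact: (dmeas_xi hxi).
have mN : measurable N.
  by apply: bigcupT_measurable => a; apply: bigcupT_measurable => b.
have X0 w l : (i.+1 < l)%N -> X i w l = 0%N.
  exact: (@hess_xi _ _ _ _ _ _ hxi (0%N, i, 0%N) w).
have N0 : P N = 0.
  apply: (measure_negligible mN); apply: negligible_bigcup => a.
  apply: negligible_bigcup => b; exists (X i @^-1` pair_event a b); split => //.
  have [ai|ai] := ltnP a i.+2; last first.
    rewrite (_ : _ @^-1` _ = set0) ?measure0//; apply/seteqP; split => // w [/=].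
    by rewrite X0.
  have [bi|bi] := ltnP b i.+2; first by rewrite [LHS]pair_probE pp0.
  rewrite (_ : _ @^-1` _ = set0) ?measure0//; apply/seteqP; split => // w [/= _].
  by rewrite (X0 w b bi).
have m1 : measurable (X i @^-1` [set r | vsize i r = 1%N]) by exact: (dmeas_xi hxi).
pose F (r : nat -> nat) : R := (\sum_(l < i.+2) (r l)%:R * 1)%R.
have mf D : measurable_fun D (fun w => (F (X i w))%:E : \bar R).
  exact: (measurable_xi_EFin hxi).
have F0 r : (0 <= F r)%R by apply: sumr_ge0 => l _; rewrite mulr1.
have -> : (\sum_(j < i.+2) rmean i j)%:E = \int[P]_w (F (X i w))%:E.
  rewrite (mean_linear hxi i (y := fun=> 1%R))// -sumEFin.
  by apply: eq_bigr => j _; rewrite rmeanE mule1.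
rewrite (ge0_negligible_integral mN)//; last by move=> w _; rewrite lee_fin.
have mTN : measurable (setT `\` N) by exact: measurableD.
apply: (@le_trans _ _ (\int[P]_(w in setT `\` N)
    (\1_(X i @^-1` [set r | vsize i r = 1%N]) w)%:E)).
  apply: ge0_le_integral => //.
  - by move=> w _; rewrite lee_fin.
  - exact/measurable_EFinP.
  move=> w [_ nN]; rewrite lee_fin /F -mulr_suml mulr1 -natr_sum -/(vsize i (X i w)).
  have v1 : (vsize i (X i w) <= 1)%N.
    rewrite leqNgt; apply/negP => /vsize_pair[a [b [_ _ pe]]].
    by apply: nN; exists a => //; exists b.
  rewrite indicE; move: v1; rewrite leq_eqVlt => /predU1P[v1|].
    by rewrite mem_set// v1.
  by rewrite ltnS leqn0 => /eqP ->.
rewrite integral_indic//; apply: le_measure; rewrite ?inE//; exact: measurableI.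
Qed.

End FiniteMeans.


(** * Local extinction *)

Section LocalExtinction.
Context (d : measure_display) (T : measurableType d) (R : realType).
Variables (P : probability T R) (p : nat -> (nat -> nat) -> R).
Variable xi : nat * nat * nat -> T -> nat -> nat.
Hypothesis hxi : offspring_family P p xi.
Hypotheses (hM : forall i, 0 < mean p i i.+1) (ok : forall k, mu_ok p k).
Hypothesis hirr : irreducible_law p.

Local Notation X i := (xi (0%N, i, 0%N)).
Local Notation x := (xvec p).
Local Notation M := (rmean p).
Local Open Scope ring_scope.

Let M0 := rmean_ge0 hxi hM ok.

Variable l : nat.

(* [visit n i] is the expected number of first visits to [l] within [n]
   generations along a line of descent of an individual of type [i]. *)
Fixpoint visit (n i : nat) : R :=
  if i == l then 1 else
  if n is n'.+1 then \sum_(j < i.+2) M i j * visit n' j else 0.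

Lemma visitS n i : visit n.+1 i = if i == l then 1 else \sum_(j < i.+2) M i j * visit n j.
Proof. by []. Qed.

Lemma visit_l n : visit n l = 1.
Proof. by case: n => [|n] /=; rewrite eqxx. Qed.

Lemma visit_ge0 n i : 0 <= visit n i.
Proof.
elim: n i => [|n IHn] i /=; case: ifP => // _.
by apply: sumr_ge0 => j _; rewrite mulr_ge0.
Qed.

Lemma visit_nd n i : visit n i <= visit n.+1 i.
Proof.
elim: n i => [|n IHn] i.
  rewrite visitS [leLHS]/=; case: ifP => // il.
  by apply: sumr_ge0 => j _; rewrite mulr_ge0// visit_ge0.
rewrite !visitS; case: ifP => // il.
by apply: ler_sum => j _; apply: ler_wpM2l.
Qed.

(** The eigenvector normalised at [l]; it bounds [visit], whose limit is therefore finite. *)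
Definition xratio i : R := x i / x l.

Local Notation x' := xratio.

Let xl0 : 0 < x l. Proof. exact: (xvec_pos ok). Qed.

Let x'_gt0 i : 0 < x' i. Proof. by rewrite /xratio divr_gt0//; exact: (xvec_pos ok). Qed.

Let x'_l : x' l = 1. Proof. by rewrite /xratio divff// gt_eqF. Qed.

Let x'_row i : \sum_(j < i.+2) M i j * x' j = x' i.
Proof. by rewrite /xratio -(rmean_xvec hxi hM ok i) mulr_suml; apply: eq_bigr => j _; rewrite mulrA. Qed.

Lemma visit_le n i : visit n i <= x' i.
Proof.
elim: n i => [|n IHn] i; [rewrite /=|rewrite visitS]; case: eqP => [->|_]; rewrite ?x'_l//.
  exact: ltW.
by rewrite -x'_row; apply: ler_sum => j _; apply: ler_wpM2l.
Qed.

Definition visits i : R := lim (visit n i @[n --> \oo]).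

Lemma visit_cvg i : visit n i @[n --> \oo] --> visits i.
Proof.
apply: nondecreasing_is_cvgn.
  by apply/nondecreasing_seqP => n; exact: visit_nd.
by exists (x' i) => _ [n _ <-]; exact: visit_le.
Qed.

Lemma visits_l : visits l = 1.
Proof.
by rewrite -(cvg_lim _ (@visit_cvg l))//; apply: lim_near_cst => //;
  apply: nearW => n; rewrite visit_l.
Qed.

Lemma visits_ge n i : visit n i <= visits i.
Proof.
apply: (@nondecreasing_cvgn_le _ (visit ^~ i)); last exact: (cvgP _ (@visit_cvg i)).
by apply/nondecreasing_seqP => m; exact: visit_nd.
Qed.

Lemma visits_le i : visits i <= x' i.
Proof. by apply: (le_cvg (@visit_cvg i) (cvg_cst _)) => n; exact: visit_le. Qed.

Lemma visits_row i : i != l -> \sum_(j < i.+2) M i j * visits j = visits i.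
Proof.
move=> il; have A : \sum_(j < i.+2) M i j * visit n j @[n --> \oo] -->
    \sum_(j < i.+2) M i j * visits j.
  apply: (@cvg_sum_ord _ i.+2 (fun n j => M i j * visit n j) (fun j => M i j * visits j)) => j.
  by apply: cvgM; [exact: cvg_cst|exact: visit_cvg].
have : visit n.+1 i @[n --> \oo] --> visits i.
  by have := @visit_cvg i; rewrite -cvg_shiftS.
under eq_fun do rewrite visitS (negPf il).
by move=> B; rewrite -(cvg_lim _ A)// -(cvg_lim _ B).
Qed.

(** Away from [l] this is an equality. At [l], where [visits] is reset to 1, the row is at most that
    of [xratio], which equals 1. *)
Lemma visits_super i : \sum_(j < i.+2) M i j * visits j <= visits i.
Proof.
have [->|il] := eqVneq i l; last by rewrite visits_row.
rewrite visits_l -x'_l -x'_row; apply: ler_sum => j _; apply: ler_wpM2l => //.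
exact: visits_le.
Qed.

(** First moment bound: a visit to [l] within [m] generations requires a first visit along some line
    of descent. *)
Lemma avoid_visit m i : 1 - avoid p l m i <= visit m i.
Proof.
elim: m i => [|m IHm] i /=; first by case: eqP => _ /=; rewrite ?subrr// subr0.
case: eqP => [_|/eqP il] /=; first by rewrite mul0r subr0.
rewrite mul1r; apply: le_trans (gf_compl_le_lin hxi hM ok i (avoid_box hxi l m)) _.
by apply: ler_sum => j _; apply: ler_wpM2l => //; exact: IHm.
Qed.

Lemma gfiter_visits N m i : 1 - gfiter p N (avoid p l m) i <= visits i.
Proof.
elim: N i => [|N IHN] i /=.
  exact: le_trans (avoid_visit m i) (visits_ge m i).
have bg := gfiter_box hxi N (avoid_box hxi l m).
apply: le_trans (gf_compl_le_lin hxi hM ok i bg) _.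
apply: le_trans (visits_super i); apply: ler_sum => j _; apply: ler_wpM2l => //.
Qed.

Variables (V : nat -> nat -> R) (W : nat -> R).
Hypothesis VE : forall N i, gfiter p N (avoid p l m) i @[m --> \oo] --> V N i.
Hypothesis WE : forall i, V N i @[N --> \oo] --> W i.

(* The probability that a process started from type [i] visits [l] infinitely often. *)
Definition io_prob i : R := 1 - W i.

Local Notation w := io_prob.

Lemma V_box N : box (V N).
Proof.
move=> i; apply/andP; split.
  by apply: (le_cvg (cvg_cst _) (@VE N i)) => m; case/andP: (gfiter_box hxi N (avoid_box hxi l m) i).
by apply: (le_cvg (@VE N i) (cvg_cst _)) => m; case/andP: (gfiter_box hxi N (avoid_box hxi l m) i).
Qed.

Lemma io_prob_ge0 i : 0 <= w i.
Proof.
rewrite subr_ge0; apply: (le_cvg (@WE i) (cvg_cst _)) => N.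
by case/andP: (V_box N i).
Qed.

Lemma io_prob_visits i : w i <= visits i.
Proof.
apply: (le_cvg (cvg_compl (@WE i)) (cvg_cst _)) => N.
apply: (le_cvg (cvg_compl (@VE N i)) (cvg_cst _)) => m.
exact: gfiter_visits.
Qed.

Lemma io_prob_ineq i a b : (a < i.+2)%N -> (b < i.+2)%N ->
  w i + pair_prob P xi i a b * (w a * w b) <= \sum_(j < i.+2) M i j * w j.
Proof.
move=> ai bi.
have step N : 1 - V N.+1 i + pair_prob P xi i a b * ((1 - V N a) * (1 - V N b)) <=
    \sum_(j < i.+2) M i j * (1 - V N j).
  apply: (gf_compl_limit hxi hM ok (u := fun m => gfiter p N (avoid p l m))
    (v := fun m => gfiter p N.+1 (avoid p l m)) (g := V N.+1)) => // m.
  exact: (gfiter_box hxi N (avoid_box hxi l m)).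
have A1 : (1 - V N.+1 i + pair_prob P xi i a b * ((1 - V N a) * (1 - V N b)))
   @[N --> \oo] --> w i + pair_prob P xi i a b * (w a * w b).
  apply: cvgD; first by apply: cvg_compl; have := @WE i; rewrite -cvg_shiftS.
  apply: cvgM; first exact: cvg_cst.
  by apply: cvgM; exact: cvg_compl.
have fine_moment2 : (\sum_(j < i.+2) M i j * (1 - V N j)) @[N --> \oo] -->
    (\sum_(j < i.+2) M i j * w j).
  apply: (@cvg_sum_ord _ i.+2 (fun N j => M i j * (1 - V N j)) (fun j => M i j * w j)) => j.
  by apply: cvgM; [exact: cvg_cst|exact: cvg_compl].
exact: (le_cvg A1 fine_moment2).
Qed.

Lemma io_prob_sub i : w i <= \sum_(j < i.+2) M i j * w j.
Proof.
apply: le_trans (io_prob_ineq (ltn0Sn _) (ltn0Sn _)).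
by rewrite lerDl !mulr_ge0 ?io_prob_ge0// (pair_prob_ge0 hxi).
Qed.

(** Iterating [w <= M w] up to the first visit to [l] gives the term with [w l]. Lines that have not
    met [l] after [n] steps contribute at most [visits - visit n], by [w <= visits], and this tail
    vanishes in the limit. *)
Lemma io_prob_le i : w i <= w l * visits i.
Proof.
have h n : forall i, w i <= w l * visit n i + (visits i - visit n i).
  elim: n => [|n IHn] j.
    have [->|jl] := eqVneq j l; first by rewrite visit_l visits_l subrr addr0 mulr1.
    by rewrite /= (negPf jl) mulr0 add0r subr0 io_prob_visits.
  have [->|jl] := eqVneq j l; first by rewrite visit_l visits_l subrr addr0 mulr1.
  apply: le_trans (io_prob_sub j) _; rewrite visitS (negPf jl) -visits_row//.
  rewrite mulr_sumr -sumrB -big_split /=; apply: ler_sum => k _.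
  by rewrite mulrCA -mulrBr -mulrDr; apply: ler_wpM2l => //; exact: IHn.
have A : (w l * visit n i + (visits i - visit n i)) @[n --> \oo] -->
    w l * visits i + (visits i - visits i).
  apply: cvgD; first by apply: cvgM; [exact: cvg_cst|exact: visit_cvg].
  by apply: cvgB; [exact: cvg_cst|exact: visit_cvg].
rewrite -[leRHS]addr0 -(subrr (visits i)).
by apply: (le_cvg (cvg_cst _) A) => n; exact: h.
Qed.

Lemma mean_index a b : (0 < mean p a b)%E -> (b < a.+2)%N.
Proof.
by move=> Mab; rewrite ltnNge; apply/negP => ab; move: Mab; rewrite (mean_out hxi)// ltxx.
Qed.

(** At a contact point, [h - f >= 0] and [M (h - f) <= h - f = 0], so [h - f] vanishes at every
    successor and contact spreads along paths. *)
Lemma maximum_principle (f : nat -> R) (h : nat -> R) s a :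
  (forall i, f i <= h i) -> (forall i, f i <= \sum_(j < i.+2) M i j * f j) ->
  (forall i, \sum_(j < i.+2) M i j * h j <= h i) ->
  f a = h a -> path (fun x y => 0 < mean p x y)%E a s -> f (last a s) = h (last a s).
Proof.
move=> fh fsub hsup; elim: s a => [|b s IHs] a //= fa /andP[Mab pb].
apply: IHs pb; apply/eqP; rewrite eq_sym -subr_eq0; apply/eqP.
apply: (@sum_null_term _ a.+2 (M a) (fun j => h j - f j) b).
- exact: M0.
- by move=> j; rewrite subr_ge0.
- rewrite (eq_bigr (fun j : 'I_a.+2 => M a j * h j - M a j * f j)); last by move=> j _; rewrite mulrBr.
  by rewrite sumrB subr_le0 (le_trans (hsup a))// -fa.
- exact: mean_index.
- by rewrite (rmean_gt0 hxi hM ok).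
Qed.

Lemma io_prob_eq0 : non_singular p -> w l = 0.
Proof.
move=> [i0 hi0]; apply/eqP; rewrite eq_le io_prob_ge0 andbT leNgt; apply/negP => wl0.
(* First contact at [l]: [w] against [w l * x'], where [x' l = 1]. *)
have wx i : w i = w l * x' i.
  have [s [ps <-]] := hirr l i.
  apply: (@maximum_principle w (fun i => w l * x' i) s l) => //.
  - move=> j; apply: le_trans (io_prob_le j) _.
    by apply: ler_wpM2l; [exact: io_prob_ge0|exact: visits_le].
  - exact: io_prob_sub.
  - move=> j; rewrite -[leRHS]/(w l * x' j) -x'_row mulr_sumr.
    by apply: ler_sum => k _; rewrite mulrCA.
  - by rewrite x'_l mulr1.
have w_gt0 i : 0 < w i by rewrite wx mulr_gt0.
(* Equality in [w <= M w] leaves no room for the pair term. *)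
have pp0 i a b : (a < i.+2)%N -> (b < i.+2)%N -> pair_prob P xi i a b = 0.
  move=> ai bi; apply/eqP; rewrite eq_le (pair_prob_ge0 hxi) andbT.
  have := io_prob_ineq ai bi.
  have -> : \sum_(j < i.+2) M i j * w j = w i.
    rewrite wx -x'_row mulr_sumr; apply: eq_bigr => j _.
    by rewrite wx mulrCA.
  by rewrite gerDl pmulr_lle0// mulr_gt0.
have rows i : \sum_(j < i.+2) M i j <= 1.
  rewrite -lee_fin; apply: le_trans (mean_sum_le hxi hM ok (pp0 i)) _.
  by apply: probability_le1; exact: (dmeas_xi hxi).
have visit1 n i : visit n i <= 1.
  elim: n i => [|n IHn] i; [rewrite /=|rewrite visitS]; case: ifP => // _.
  apply: le_trans (rows i); apply: ler_sum => j _.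
  by rewrite ler_piMr.
(* Here [w l * x' i = w i <= w l * visits i], and [visits] is at most 1. *)
have x'1 i : x' i <= 1.
  apply: (@le_trans _ _ (visits i)).
    by rewrite -(ler_pM2l wl0) -wx io_prob_le.
  by apply: (le_cvg (@visit_cvg i) (cvg_cst _)) => n.
(* Second contact at [l]: [x'] against the constant 1. *)
have x'E i : x' i = 1.
  have [s [ps <-]] := hirr l i.
  apply: (@maximum_principle x' (fun=> 1) s l) => //.
  - by move=> j; rewrite x'_row.
  - by move=> j; under eq_bigr do rewrite mulr1; exact: rows.
have : \sum_(j < i0.+2) M i0 j = 1.
  by rewrite -(x'E i0) -x'_row; apply: eq_bigr => j _; rewrite x'E mulr1.
move=> S1; have := mean_sum_le hxi hM ok (pp0 i0); rewrite S1.
by rewrite -(law_prob hxi) leNgt; move/negP; apply.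
Qed.

End LocalExtinction.


(** * Global extinction *)

Section GlobalExtinction.
Context (d : measure_display) (T : measurableType d) (R : realType).
Variables (P : probability T R) (p : nat -> (nat -> nat) -> R).
Variable xi : nat * nat * nat -> T -> nat -> nat.
Hypothesis hxi : offspring_family P p xi.
Hypotheses (hM : forall i, 0 < mean p i i.+1) (ok : forall k, mu_ok p k).

Local Notation X i := (xi (0%N, i, 0%N)).
Local Notation x := (xvec p).
Local Notation M := (rmean p).

Let M0 := rmean_ge0 hxi hM ok.
Let xpos := xvec_pos ok.

Section Real.
Local Open Scope ring_scope.

Let box0 : box (fun=> 0 : R). Proof. by move=> i; rewrite lexx ler01. Qed.

Variable Q : nat -> R.
Hypothesis QE : forall i, gfiter p N (fun=> 0) i @[N --> \oo] --> Q i.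

Lemma Q_le1 i : Q i <= 1.
Proof.
apply: (le_cvg (@QE i) (cvg_cst _)) => N.
by case/andP: (gfiter_box hxi N box0 i).
Qed.

Lemma Q_le_sub (t : nat -> R) i : box t -> (forall i, gf p i t <= t i) -> Q i <= t i.
Proof.
move=> bt ht; apply: (le_cvg (@QE i) (cvg_cst _)) => N.
by apply: (gfiter_le_sub hxi N box0 bt) => // j; case/andP: (bt j).
Qed.

Definition surv i : R := 1 - Q i.
Local Notation w := surv.

Lemma surv_ineq i a b : (a < i.+2)%N -> (b < i.+2)%N ->
  w i + pair_prob P xi i a b * (w a * w b) <= \sum_(j < i.+2) M i j * w j.
Proof.
move=> ai bi.
apply: (gf_compl_limit hxi hM ok (u := fun N => gfiter p N (fun=> 0))
  (v := fun N => gfiter p N.+1 (fun=> 0))) => //.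
- by move=> N; exact: (gfiter_box hxi N box0).
- by have := @QE i; rewrite -cvg_shiftS.
Qed.

(** As [w / x] is nondecreasing up to [k], the terms [j <= k] of [M w] are at most [w k / x k] times
    the same terms of [M x = x]. What remains of [surv_ineq] bounds the next increment of the ratio
    from below. *)
Lemma surv_increment k : (forall j, (j < k)%N -> w j / x j <= w j.+1 / x j.+1) ->
  pair_prob P xi k k.+1 k.+1 * w k.+1 ^+ 2 <=
  M k k.+1 * x k.+1 * (w k.+1 / x k.+1 - w k / x k).
Proof.
move=> IH; have mono j : (j <= k)%N -> w j / x j <= w k / x k.
  move=> jk; rewrite -(subKn jk); elim: (k - j)%N => [|m IHm]; first by rewrite subn0.
  have [mk|mk] := leqP k m; first by move: IHm; rewrite !(eqP mk) (eqP (leqW mk)).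
  by apply: le_trans (IH _ _) _; rewrite -?subSn ?subSS//; lia.
have := surv_ineq (ltnSn k.+1) (ltnSn k.+1).
rewrite big_ord_recr /=.
have : \sum_(j < k.+1) M k j * w j <= w k / x k * (x k - M k k.+1 * x k.+1).
  have -> : x k - M k k.+1 * x k.+1 = \sum_(j < k.+1) M k j * x j.
    by rewrite -{1}(rmean_xvec hxi hM ok k) big_ord_recr /= addrK.
  rewrite mulr_sumr; apply: ler_sum => j _; rewrite mulrCA; apply: ler_wpM2l => //.
  by rewrite -ler_pdivrMr// mono// -ltnS.
have xk := xpos k; have xk1 := xpos k.+1.
have E1 : w k / x k * (x k - M k k.+1 * x k.+1) = w k - M k k.+1 * x k.+1 * (w k / x k).
  by field; rewrite gt_eqF.
have E2 : M k k.+1 * x k.+1 * (w k.+1 / x k.+1 - w k / x k) =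
   M k k.+1 * w k.+1 - M k k.+1 * x k.+1 * (w k / x k).
  by field; rewrite !gt_eqF.
rewrite E1 E2 expr2; lra.
Qed.

Lemma rmean_up_gt0 k : 0 < M k k.+1.
Proof. by rewrite (rmean_gt0 hxi hM ok). Qed.

Lemma surv_ratio_nd k : w k / x k <= w k.+1 / x k.+1.
Proof.
elim/ltn_ind: k => k IH; have := surv_increment IH.
have : 0 <= pair_prob P xi k k.+1 k.+1 * w k.+1 ^+ 2.
  by rewrite mulr_ge0 ?(pair_prob_ge0 hxi)// sqr_ge0.
move=> h1 h2; rewrite -subr_ge0 -(pmulr_rge0 _ (mulr_gt0 (rmean_up_gt0 k) (xpos k.+1))).
exact: le_trans h2.
Qed.

(** For [r = w / x], the increment bound reads [r_(k+1) - r_k >= c / B * r_(k+1) ^+ 2 * x_(k+1)]. As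
    [r_k <= r_(k+1)], division by [r_k * r_(k+1)] gives [1 / r_k - 1 / r_(k+1) >= c / B * x_(k+1)],
    which telescopes. *)
Lemma extinction_sum (c B : R) i n : 0 < c -> 0 < B ->
  (forall k, c <= pair_prob P xi k k.+1 k.+1) -> (forall k, M k k.+1 <= B) ->
  0 < w i -> \sum_(i <= k < i + n) x k.+1 <= B / c * (x i / w i).
Proof.
move=> c0 B0 hc hB wi0.
have rpos m : 0 < w (i + m)%N / x (i + m)%N.
  elim: m => [|m IHm]; first by rewrite addn0 divr_gt0.
  by apply: lt_le_trans IHm _; rewrite addnS surv_ratio_nd.
have step k : 0 < w k / x k -> c / B * x k.+1 <= x k / w k - x k.+1 / w k.+1.
  move=> rk; have rk1 : 0 < w k.+1 / x k.+1 by exact: lt_le_trans (surv_ratio_nd k).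
  have xk := xpos k; have xk1 := xpos k.+1; have mk := rmean_up_gt0 k.
  have wk : 0 < w k by have := mulr_gt0 rk xk; rewrite divfK// gt_eqF.
  have wk1 : 0 < w k.+1 by have := mulr_gt0 rk1 xk1; rewrite divfK// gt_eqF.
  have inc := @surv_increment k (fun j _ => surv_ratio_nd j).
  have inc2 : c * w k.+1 ^+ 2 <= B * x k.+1 * (w k.+1 / x k.+1 - w k / x k).
    apply: (@le_trans _ _ (pair_prob P xi k k.+1 k.+1 * w k.+1 ^+ 2)).
      by rewrite ler_wpM2r// sqr_ge0.
    apply: (le_trans inc); rewrite ler_wpM2r ?subr_ge0 ?surv_ratio_nd//.
    by rewrite ler_wpM2r// ltW.
  set r := w k / x k in rk inc inc2 *; set r1 := w k.+1 / x k.+1 in rk1 inc inc2 *.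
  have rr1 : r <= r1 by exact: surv_ratio_nd.
  have -> : x k / w k = r^-1 by rewrite /r invf_div.
  have -> : x k.+1 / w k.+1 = r1^-1 by rewrite /r1 invf_div.
  have wE : w k.+1 = r1 * x k.+1 by rewrite /r1 divfK// gt_eqF.
  rewrite wE exprMn in inc2.
  have -> : r^-1 - r1^-1 = (r1 - r) / (r * r1) by field; rewrite !gt_eqF.
  have h1 : c * r1 ^+ 2 * x k.+1 <= B * (r1 - r).
    rewrite -(ler_pM2r xk1); apply: le_trans (le_trans inc2 _); last first.
      by rewrite mulrAC.
    by rewrite -!mulrA -expr2 mulrA.
  rewrite ler_pdivlMr; last exact: mulr_gt0.
  have -> : c / B * x k.+1 * (r * r1) = c * (r * r1) * x k.+1 / B.
    by field; rewrite gt_eqF.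
  rewrite ler_pdivrMr// (mulrC (r1 - r)); apply: le_trans h1.
  apply: ler_wpM2r; first exact: ltW.
  apply: ler_wpM2l; first exact: ltW.
  by rewrite expr2 ler_wpM2r// ltW.
have tele m : c / B * \sum_(i <= k < i + m) x k.+1 <= x i / w i - x (i + m)%N / w (i + m)%N.
  elim: m => [|m IHm]; first by rewrite addn0 big_geq// mulr0 subrr.
  rewrite addnS big_nat_recr ?leq_addr//= mulrDr.
  by have := step (i + m)%N (rpos m); lra.
have := tele n; have : 0 < x (i + n)%N / w (i + n)%N.
  by rewrite -invf_div invr_gt0.
move=> h1 h2; rewrite mulrC -ler_pdivrMr; last exact: divr_gt0.
rewrite invf_div mulrC; lra.
Qed.

Variables (A : nat -> nat -> nat -> R) (S : nat -> R) (xmax Smax : R).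
Hypothesis hA : forall k i j, (i < k.+2)%N -> (j < k.+2)%N ->
  (\int[P]_y ((X k y j * (X k y i - (i == j)))%:R)%:E = (A k i j)%:E)%E.
Hypothesis hS : forall k, 0 <= S k <= Smax.
Hypothesis hx : forall k, x k <= xmax.
Hypothesis hAS : forall k, \sum_(j < k.+2) M k j * (x j * S j) =
  x k * S k + \sum_(i < k.+2) \sum_(j < k.+2) A k i j * (x i * x j).

Let A_ge0 k i j : (i < k.+2)%N -> (j < k.+2)%N -> 0 <= A k i j.
Proof.
move=> ik jk; rewrite -lee_fin -hA//; apply: integral_ge0 => y _.
by rewrite lee_fin.
Qed.

(* For [w = e x (1 + e S)], the first order defect [M w - w =
   e^2 A(x,x)] dominates the second order term [A(w,w) / 2]. *)
Lemma survival : Q 0 < 1.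
Proof.
have xmax0 : 0 < xmax by exact: lt_le_trans (xpos 0%N) (hx 0%N).
have Smax0 : 0 <= Smax by have := hS 0%N; lra.
(* This makes both [e * S k] and [e * x k] at most 1/4. *)
pose D := 4 * (Smax + xmax + 1).
have D0 : 0 < D by rewrite /D; lra.
pose e := D^-1.
have e0 : 0 < e by rewrite invr_gt0.
have eD : e * D = 1 by rewrite mulVf// gt_eqF.
have eS k : 0 <= e * S k <= 4^-1.
  have /andP[s0 s1] := hS k; rewrite mulr_ge0 ?(ltW e0)//=.
  have : 0 <= e * (Smax - S k) by rewrite mulr_ge0 ?(ltW e0)// subr_ge0.
  have : 0 < e * xmax by rewrite mulr_gt0.
  rewrite /D in eD; lra.
have ex k : 0 < e * x k <= 4^-1.
  rewrite mulr_gt0//=.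
  have : 0 <= e * (xmax - x k) by rewrite mulr_ge0 ?(ltW e0)// subr_ge0.
  have : 0 <= e * Smax by rewrite mulr_ge0 ?(ltW e0).
  rewrite /D in eD; lra.
pose v k := e * x k * (1 + e * S k).
have vx k : e * x k <= v k <= 5 / 4 * (e * x k).
  have /andP[a1 a2] := eS k; have /andP[b1 b2] := ex k; rewrite /v; apply/andP; split; nra.
have v0 k : 0 <= v k by have /andP[h _] := vx k; have /andP[h' _] := ex k; lra.
have bv : box v by move=> k; rewrite v0 /=; have := vx k; have := ex k; lra.
have bt : box (fun k => 1 - v k) by move=> k; have := bv k; lra.
have sub k : v k <= 1 - gf p k (fun l => 1 - v l).
  pose AA (y : nat -> R) := \sum_(i < k.+2) \sum_(j < k.+2) A k i j * (y i * y j).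
  have low : \sum_(l < k.+2) M k l * v l <=
      1 - gf p k (fun l => 1 - v l) + AA v / 2.
    have := gf_lower hxi k bv.
    under eq_bigr do rewrite (rmeanE hxi hM ok) -EFinM.
    rewrite sumEFin; under [Y in (_ <= _ + Y)%E -> _]eq_bigr => i _.
      under eq_bigr do rewrite hA// -EFinM.
      rewrite sumEFin; over.
    rewrite sumEFin -EFinD lee_fin; congr (_ <= _ + _).
    rewrite /AA mulr_suml; apply: eq_bigr => i _; rewrite mulr_suml.
    by apply: eq_bigr => j _; rewrite !mulrA.
  have Mv : \sum_(l < k.+2) M k l * v l = v k + e ^+ 2 * AA x.
    rewrite (eq_bigr (fun l : 'I_k.+2 => e * (M k l * x l) + e ^+ 2 * (M k l * (x l * S l)))).
      by rewrite big_split /= -!mulr_sumr (rmean_xvec hxi hM ok) hAS /v /AA; ring.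
    by move=> l _; rewrite /v; ring.
  (* The loss [AA v / 2] is thus at most 25/32 of the gain [e ^+ 2 * AA x]. *)
  have AAv : AA v <= (5 / 4 * e) ^+ 2 * AA x.
    rewrite /AA mulr_sumr; apply: ler_sum => i _; rewrite mulr_sumr; apply: ler_sum => j _.
    rewrite [leRHS]mulrCA; apply: ler_wpM2l; first exact: A_ge0.
    have /andP[_ h1] := vx i; have /andP[_ h2] := vx j.
    apply: (@le_trans _ _ ((5 / 4 * (e * x i)) * (5 / 4 * (e * x j)))); first exact: ler_pM.
    by rewrite le_eqVlt; apply/orP; left; apply/eqP; ring.
  have AA0 : 0 <= AA x.
    apply: sumr_ge0 => i _; apply: sumr_ge0 => j _; rewrite mulr_ge0 ?A_ge0//.
    by rewrite mulr_ge0// ltW.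
  have : 0 <= e ^+ 2 * AA x by rewrite mulr_ge0// sqr_ge0.
  rewrite Mv in low; rewrite exprMn -mulrA in AAv; lra.
have : Q 0%N <= 1 - v 0%N by apply: (@Q_le_sub (fun k => 1 - v k) 0%N bt) => k; have := sub k; lra.
by have := vx 0%N; have := ex 0%N; lra.
Qed.

End Real.
End GlobalExtinction.


(** * The recursion for [a] in terms of the eigenvector *)

Section SecondMoments.
Context (d : measure_display) (T : measurableType d) (R : realType).
Variables (P : probability T R) (p : nat -> (nat -> nat) -> R).
Variable xi : nat * nat * nat -> T -> nat -> nat.
Hypothesis hxi : offspring_family P p xi.
Hypotheses (hM : forall i, 0 < mean p i i.+1) (ok : forall k, mu_ok p k).
Variable C : R.
Hypothesis hC : forall k, lh_a p k / lh_mu p k <= C%:E.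

Local Notation X i := (xi (0%N, i, 0%N)).
Local Notation x := (xvec p).
Local Notation M := (rmean p).

Let M0 := rmean_ge0 hxi hM ok.
Let xpos := xvec_pos ok.

Definition fine_moment2 k i j : R := fine (moment2 p k i j).
Definition fine_a k : R := fine (lh_a p k).
(* In terms of [beta_k = a_k x_{k+1}^2 / x_k] and [S_k = beta_0 + ... + beta_{k-1}],
   the recursion for [a_k] reads [M(xS) = xS + A(x,x)]. *)
Definition beta k : R := (fine_a k * x k.+1 ^+ 2 / x k)%R.
Definition beta_sum k : R := (\sum_(0 <= j < k) beta j)%R.

Lemma lh_mu_xvec k : lh_mu p k = (x k / x k.+1)%:E.
Proof.
have := @mprodE _ p k.+1 k (fun j _ => ok j) (leqnSn k).
by rewrite /mprod big_nat1.
Qed.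

Lemma moment2E k i j : moment2 p k i j =
  \int[P]_w ((X k w j * (X k w i - (i == j)))%:R)%:E.
Proof. by rewrite (moment2_integral hxi)// (rmeanE hxi hM ok) ltry. Qed.

Lemma moment2_ge0 k i j : 0 <= moment2 p k i j.
Proof. by rewrite moment2E; apply: integral_ge0 => w _; rewrite lee_fin. Qed.

(** By [M x = x], the row without its last term is [x k - M k k.+1 * x k.+1]. *)
Lemma denomE k : 1 - \sum_(0 <= i < k.+1) mean p k i * mprod (lh_mu p) i k =
  (M k k.+1 * x k.+1 / x k)%:E.
Proof.
rewrite big_mkord.
transitivity (1 - (\sum_(i < k.+1) M k i * x i)%R%:E * (x k)^-1%:E).
  congr (_ - _); rewrite -EFinM mulr_suml -sumEFin; apply: eq_bigr => i _.
  rewrite (rmeanE hxi hM ok) (mprodE (fun j _ => ok j)); last by rewrite -ltnS.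
  by rewrite -EFinM mulrA.
rewrite -EFinM -EFinB; congr EFin.
have := rmean_xvec hxi hM ok k; rewrite big_ord_recr /= => h.
have -> : (\sum_(i < k.+1) M k i * x i = x k - M k k.+1 * x k.+1)%R by rewrite -h addrK.
by field; rewrite gt_eqF.
Qed.

Lemma prod_mu2 j k : (j <= k)%N ->
  \prod_(j.+1 <= l < k.+1) lh_mu p l ^+ 2 = ((x j.+1 / x k.+1) ^+ 2)%:E.
Proof.
move=> jk.
have /(congr1 fine) := @mprodE _ p k.+1 j.+1 (fun j _ => ok j) jk.
rewrite /mprod /= => h.
transitivity (\prod_(j.+1 <= l < k.+1) ((fine (lh_mu p l)) ^+ 2)%:E).
  by apply: eq_bigr => l _; rewrite lh_mu_xvec EFin_expe.
rewrite prodEFin prodrXl -h; congr ((_ ^+ 2)%:E).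
by under [in RHS]eq_bigr do rewrite lh_mu_xvec; rewrite prodEFin;
  apply: eq_bigr => l _; rewrite lh_mu_xvec.
Qed.

Definition quad k : R := (\sum_(i < k.+2) \sum_(j < k.+2) fine_moment2 k i j * (x i * x j))%R.

(** The claims are proved together, since [a_k] involves the earlier values. An infinite second
    moment would make [a_k / mu_k] infinite, against [hC]; the last claim is the recursion for [a_k]
    multiplied out. *)
Lemma fine_aP k : [/\ lh_a p k = (fine_a k)%:E, (0 <= fine_a k)%R,
  (forall i j, (i < k.+2)%N -> (j < k.+2)%N -> moment2 p k i j = (fine_moment2 k i j)%:E) &
  (beta k * M k k.+1 * x k.+1 =
   \sum_(i < k.+1) M k i * x i * (\sum_(i <= j < k) beta j) + quad k)%R].
Proof.
elim/ltn_ind: k => k IH.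
have xk := xpos k; have xk1 := xpos k.+1.
have mk : (0 < M k k.+1)%R by rewrite (rmean_gt0 hxi hM ok).
have D0 : (0 < M k k.+1 * x k.+1 / x k)%R by rewrite divr_gt0// mulr_gt0.
have beta0 j : (j < k)%N -> (0 <= beta j)%R.
  by move=> /IH[_ a0 _ _]; rewrite /beta divr_ge0 ?mulr_ge0 ?sqr_ge0// ltW.
pose U := (\sum_(i < k.+1) M k i * x i * (\sum_(i <= j < k) beta j))%R.
have U0 : (0 <= U)%R.
  apply: sumr_ge0 => i _; apply: mulr_ge0; first by rewrite mulr_ge0// ltW.
  by rewrite big_seq; apply: sumr_ge0 => j; rewrite mem_index_iota => /andP[_ /beta0].
(* The second moments stay in the extended reals until [hC] shows this sum to be finite. *)
pose Y := \sum_(i < k.+2) \sum_(j < k.+2) (x i * x j / x k.+1 ^+ 2)%:E * moment2 p k i j.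
have E : lh_a p k = ((U / x k.+1 ^+ 2)%:E + Y) * ((M k k.+1 * x k.+1 / x k)^-1)%:E.
  rewrite lh_aE denomE inver gt_eqF//; congr ((_ + _) * _).
    rewrite big_mkord /U mulr_suml -sumEFin; apply: eq_bigr => i _.
    rewrite (rmeanE hxi hM ok).
    transitivity ((M k i)%:E * (\sum_(i <= j < k) x i * beta j / x k.+1 ^+ 2)%R%:E).
      congr (_ * _); rewrite -sumEFin; apply: eq_big_nat => j /andP[ij jk].
      have [-> _ _ _] := IH j jk.
      rewrite (mprodE (fun j _ => ok j) ij) (prod_mu2 (ltnW jk)) -!EFinM; congr EFin.
      by rewrite /beta; field; rewrite !gt_eqF.
    rewrite -EFinM; congr EFin; rewrite -mulr_suml -mulr_sumr; ring.
  rewrite big_mkord /Y; apply: eq_bigr => i _; rewrite big_mkord; apply: eq_bigr => j _.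
  rewrite !(mprodE (fun j _ => ok j)); [|by rewrite -ltnS..].
  by rewrite -EFinM; congr (_%:E * _); field; rewrite gt_eqF.
have c0 i j : (0 < x i * x j / x k.+1 ^+ 2)%R.
  by rewrite divr_gt0 ?exprn_gt0// mulr_gt0.
have term0 i j : 0 <= (x i * x j / x k.+1 ^+ 2)%:E * moment2 p k i j.
  by rewrite mule_ge0 ?moment2_ge0// lee_fin ltW.
have Y0 : 0 <= Y by apply: sume_ge0 => i _; apply: sume_ge0 => j _.
have Yfin : Y < +oo.
  rewrite ltey; apply/eqP => Yy; have := hC k; rewrite E Yy lh_mu_xvec.
  rewrite addey// mulyr gtr0_sg ?invr_gt0// mul1e inver gt_eqF ?divr_gt0//.
  by rewrite mulyr gtr0_sg ?invr_gt0 ?divr_gt0// mul1e leye_eq.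
have mfin i j : (i < k.+2)%N -> (j < k.+2)%N -> moment2 p k i j = (fine_moment2 k i j)%:E.
  move=> ik jk; rewrite /fine_moment2 fineK// ge0_fin_numE ?moment2_ge0//.
  have : (x i * x j / x k.+1 ^+ 2)%:E * moment2 p k i j < +oo.
    apply: le_lt_trans Yfin; apply: (@le_trans _ _ (\sum_(j < k.+2)
       (x i * x j / x k.+1 ^+ 2)%:E * moment2 p k i j)).
      exact: (le_sum_term (F := fun j => (x i * x j / x k.+1 ^+ 2)%:E * moment2 p k i j)).
    apply: (le_sum_term (F := fun i => \sum_(j < k.+2)
       (x i * x j / x k.+1 ^+ 2)%:E * moment2 p k i j)) => // i'.
    by apply: sume_ge0.
  have := moment2_ge0 k i j; case: (moment2 p k i j) => [r _ _|_|]//; first exact: ltry.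
  by rewrite mulry gtr0_sg// mul1e.
have YE : Y = (quad k / x k.+1 ^+ 2)%:E.
  rewrite /Y /quad mulr_suml -sumEFin; apply: eq_bigr => i _.
  rewrite mulr_suml -sumEFin; apply: eq_bigr => j _.
  rewrite mfin// -EFinM; congr EFin; ring.
have aE : lh_a p k = ((U + quad k) / x k.+1 ^+ 2 / (M k k.+1 * x k.+1 / x k))%:E.
  by rewrite E YE -EFinD -EFinM; congr EFin; rewrite -mulrDl.
have quad0 : (0 <= quad k)%R.
  apply: sumr_ge0 => i _; apply: sumr_ge0 => j _; rewrite mulr_ge0//; last first.
    by rewrite mulr_ge0// ltW.
  by rewrite -lee_fin -mfin// moment2_ge0.
have arE : fine_a k = ((U + quad k) / x k.+1 ^+ 2 / (M k k.+1 * x k.+1 / x k))%R.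
  by rewrite /fine_a aE.
split => //.
- by rewrite arE.
- rewrite arE divr_ge0 ?(ltW D0)// divr_ge0 ?sqr_ge0//; exact: addr_ge0.
- by rewrite -/U /beta arE; field; rewrite !gt_eqF.
Qed.

Lemma beta_ge0 k : (0 <= beta k)%R.
Proof.
have [_ a0 _ _] := fine_aP k.
by rewrite /beta divr_ge0 ?mulr_ge0 ?sqr_ge0// ltW.
Qed.

Lemma fine_a_le k : (fine_a k * x k.+1 / x k <= C)%R.
Proof.
have [aE _ _ _] := fine_aP k; have := hC k; rewrite aE lh_mu_xvec inver.
rewrite gt_eqF ?divr_gt0// -EFinM lee_fin invf_div mulrA.
exact.
Qed.

Lemma beta_le k : (beta k <= C * x k.+1)%R.
Proof.
have -> : beta k = (fine_a k * x k.+1 / x k * x k.+1)%R.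
  by rewrite /beta; field; rewrite gt_eqF.
by apply: ler_wpM2r; [exact: ltW|exact: fine_a_le].
Qed.

(** The inner sums of [fine_aP] are differences [beta_sum k - beta_sum i], and [beta k] is the last
    increment; the terms with [beta_sum k] combine through [M x = x]. *)
Lemma rmean_beta_sum k : (\sum_(j < k.+2) M k j * (x j * beta_sum j) = x k * beta_sum k + quad k)%R.
Proof.
have [_ _ _ h] := fine_aP k.
have -> : quad k = (beta k * M k k.+1 * x k.+1 -
    \sum_(i < k.+1) M k i * x i * (\sum_(i <= j < k) beta j))%R by rewrite h; ring.
rewrite big_ord_recr /= {2}/beta_sum big_nat_recr//= -/(beta_sum k).
have -> : (\sum_(i < k.+1) M k i * x i * \sum_(i <= j < k) beta j =
   \sum_(i < k.+1) M k i * x i * beta_sum k - \sum_(i < k.+1) M k i * (x i * beta_sum i))%R.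
  rewrite -sumrB; apply: eq_bigr => i _; have ik : (i <= k)%N by rewrite -ltnS.
  have -> : beta_sum k = (beta_sum i + \sum_(i <= j < k) beta j)%R.
    by rewrite /beta_sum (@big_cat_nat _ _ _ i).
  ring.
rewrite -mulr_suml.
have {1}-> : x k = (\sum_(i < k.+1) M k i * x i + M k k.+1 * x k.+1)%R.
  by rewrite -{1}(rmean_xvec hxi hM ok k) big_ord_recr.
ring.
Qed.

(** Let [m = M k k.+1] and let [A] be the factorial moment at [k.+1]. One term of [quad] and
    [beta k <= C * x k.+1] give [A <= C * m]. Nonnegative variance gives [m ^+ 2 <= A + m], hence
    [m <= C + 1]. *)
Lemma rmean_up_le k : (M k k.+1 <= C + 1)%R.
Proof.
have xk := xpos k; have xk1 := xpos k.+1.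
have mk : (0 < M k k.+1)%R by rewrite (rmean_gt0 hxi hM ok).
have [_ a0 mom h] := fine_aP k.
have C0 : (0 <= C)%R.
  by apply: le_trans (fine_a_le k); rewrite divr_ge0 ?mulr_ge0// ltW.
have AM : (fine_moment2 k k.+1 k.+1 <= C * M k k.+1)%R.
  have Aq : (fine_moment2 k k.+1 k.+1 * (x k.+1 * x k.+1) <= quad k)%R.
    have t0 i j : (i < k.+2)%N -> (j < k.+2)%N -> (0 <= fine_moment2 k i j * (x i * x j))%R.
      move=> ik jk; rewrite !mulr_ge0 ?(ltW (xpos _))//.
      by rewrite -lee_fin -mom// moment2_ge0.
    rewrite /quad (bigD1 ord_max)//= (bigD1 (ord_max : 'I_k.+2))//= -addrA lerDl.
    apply: addr_ge0; first by apply: sumr_ge0 => j _; exact: t0.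
    by apply: sumr_ge0 => i _; apply: sumr_ge0 => j _; exact: t0.
  have U0 : (0 <= \sum_(i < k.+1) M k i * x i * (\sum_(i <= j < k) beta j))%R.
    apply: sumr_ge0 => i _; apply: mulr_ge0; first by rewrite mulr_ge0// ltW.
    by apply: sumr_ge0 => j _; exact: beta_ge0.
  have b := beta_le k.
  rewrite -(ler_pM2r (mulr_gt0 xk1 xk1)); apply: (le_trans Aq).
  apply: (@le_trans _ _ (beta k * M k k.+1 * x k.+1)%R); first by rewrite h lerDr.
  apply: le_trans (ler_wpM2r (ltW xk1) (ler_wpM2r (ltW mk) b)) _.
  by rewrite le_eqVlt; apply/orP; left; apply/eqP; ring.
pose m := M k k.+1.
have mX (F : (nat -> nat) -> R) D : measurable_fun D (fun w => (F (X k w))%:E).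
  exact: (measurable_xi_EFin hxi).
have mE : m%:E = \int[P]_w ((X k w k.+1)%:R)%:E.
  by rewrite -(mean_integral hxi) (rmeanE hxi hM ok).
(* The variance bound without subtraction: [2 * m * X <= X ^+ 2 + m ^+ 2] is integrated, with
   [X ^+ 2 = X * (X - 1) + X]. *)
have : ((2 * m * m)%R%:E <= (fine_moment2 k k.+1 k.+1 + m + m ^+ 2)%R%:E).
  rewrite !EFinD -mom// moment2E eqxx EFinM mE.
  have -> : (m ^+ 2)%:E = \int[P]_w cst (m ^+ 2)%:E w.
    by rewrite integral_cst// [Y in _ * Y]probability_setT mule1.
  rewrite -ge0_integralZl_EFin//; first last.
  - by rewrite mulr_ge0// ltW.
  - exact: (mX (fun r => (r k.+1)%:R)%R).
  rewrite -!ge0_integralD//; first last.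
  - exact: (mX (fun r => (r k.+1)%:R)%R).
  - exact: (mX (fun r => (r k.+1 * (r k.+1 - true))%:R)%R).
  - by move=> w _; rewrite /= lee_fin sqr_ge0.
  - exact: (mX (fun r => (r k.+1 * (r k.+1 - true))%:R + (r k.+1)%:R)%R).
  - by move=> w _; rewrite adde_ge0// lee_fin.
  apply: ge0_le_integral => //.
  - by move=> w _; rewrite -EFinM lee_fin !mulr_ge0// ltW.
  - exact: (mX (fun r => 2 * m * (r k.+1)%:R)%R).
  - exact: (mX (fun r => (r k.+1 * (r k.+1 - true))%:R + (r k.+1)%:R + m ^+ 2)%R).
  move=> w _; rewrite -EFinM -!EFinD lee_fin -natrD.
  have -> : (X k w k.+1 * (X k w k.+1 - true) + X k w k.+1 = X k w k.+1 * X k w k.+1)%N.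
    by case: (X k w k.+1) => // n; rewrite subn1 /= -mulnSr.
  rewrite natrM; have := sqr_ge0 ((X k w k.+1)%:R - m)%R; nra.
rewrite lee_fin -/m in AM *; rewrite -/m in mk *.
move=> h2; rewrite -(ler_pM2r mk); nra.
Qed.

End SecondMoments.


(** * Deduction of the local and global extinction criteria *)

Theorem theorem5 (R : realType) (p : nat -> (nat -> nat) -> R)
    (d : measure_display) (T : measurableType d) (P : probability T R)
    (xi : nat * nat * nat -> T -> nat -> nat)
    (hp : progeny_law p)
    (hxi : offspring_family P p xi)
    (hirr : irreducible_law p)
    (hns : non_singular p)
    (hM : forall i, 0 < mean p i i.+1) :
  ((forall k, 0 < lh_mu p k < +oo) <-> (forall i, q_local P xi i = 1)) /\
  ((forall i, q_local P xi i = 1) ->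
   ereal_sup (range (fun k => lh_a p k / lh_mu p k)) < +oo ->
   0 < ereal_inf (range (fun k =>
         \esum_(v in [set v | hess k v /\ (2 <= v k.+1)%N]) (p k v)%:E)) ->
   (\sum_(0 <= k <oo) (mprod (lh_mu p) 0 k.+1)^-1 = +oo <->
    forall i, q_global P xi i = 1)).
Proof.
have M0 := mean_ge0 hxi.
have part1 : (forall k, mu_ok p k) <-> (forall i, q_local P xi i = 1).
  split => [ok i|qloc].
    (* The limits of [q_localE] are chosen for all starting types at once, so that they become
       functions of the type. *)
    have /choice[VW hVW] : forall i, exists VW : (nat -> nat -> R) * (nat -> R),
      [/\ forall l N, gfiter p N (avoid p l m) i @[m --> \oo] --> VW.1 l N,
      forall l, VW.1 l N @[N --> \oo] --> VW.2 l &
      q_local P xi i = 1 <-> forall l, VW.2 l = 1%R].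
      by move=> j; have [V [W h]] := q_localE hxi j; exists (V, W).
    have [_ _ ->] := hVW i => l.
    pose V N j := (VW j).1 l N; pose W j := (VW j).2 l.
    have VE N j : gfiter p N (avoid p l m) j @[m --> \oo] --> V N j.
      by have [h _ _] := hVW j; exact: h.
    have WE j : V N j @[N --> \oo] --> W j by have [_ h _] := hVW j; exact: h.
    have wl := io_prob_eq0 hxi hM ok hirr VE WE hns.
    have := io_prob_le hxi hM ok VE WE i; rewrite wl mul0r => wi.
    have /eqP : io_prob W i = 0%R by apply/eqP; rewrite eq_le wi (io_prob_ge0 hxi VE WE).
    by rewrite /io_prob subr_eq0 => /eqP h; exact: esym h.
  (* At the first failure [k], the supercritical truncation contradicts local extinction from type
     0. *)
  elim/ltn_ind => k IH; apply: contrapT => nok.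
  have [K [y [h1 h2 h3]]] := supercritical_vector M0 hM hirr IH nok.
  exact: (survive_finite hxi hirr h1 h2 h3 (qloc 0%N)).
split; first exact: part1.
move=> /part1 ok supC infc.
have [C hC] : exists C : R, forall k, lh_a p k / lh_mu p k <= C%:E.
  have le_sup k : lh_a p k / lh_mu p k <=
      ereal_sup (range (fun k => lh_a p k / lh_mu p k)).
    by apply: ereal_sup_ubound; exists k.
  move: supC le_sup; case: (ereal_sup _) => [r _ h|//|_ h]; first by exists r.
  by exists 0%R => k; apply: le_trans (h k) _; rewrite leNye.
have [c c0 hc] : exists2 c : R, (0 < c)%R & forall k, (c <= pair_prob P xi k k.+1 k.+1)%R.
  have inf_le k : ereal_inf (range (fun k =>
         \esum_(v in [set v | hess k v /\ (2 <= v k.+1)%N]) (p k v)%:E)) <=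
      (pair_prob P xi k k.+1 k.+1)%:E.
    (* With both types equal to [k.+1], the pair event asks for two children of type [k.+1]. *)
    apply: ereal_inf_lbound; exists k => //.
    rewrite -(pair_probE hxi) (law_prob hxi 0 k 0); congr (P (_ @^-1` _)).
    apply/seteqP; split => r; rewrite /pair_event /= eqxx; last by case.
    by move=> r2; split => //; exact: leq_trans r2.
  move: infc inf_le; case: (ereal_inf _) => [r r0 h|_ h|//].
    by exists r => [|k]; [rewrite -lte_fin|rewrite -lee_fin].
  by have := h 0%N; rewrite leye_eq.
have xpos := xvec_pos ok.
have /choice[Q hQ] : forall i, exists Q : R, q_global P xi i = Q%:E /\
    gfiter p N (fun=> 0%R) i @[N --> \oo] --> Q.
  by move=> i; exact: (q_globalE hxi i).
have QE i : gfiter p N (fun=> 0%R) i @[N --> \oo] --> Q i by have [_] := hQ i.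
(* The reciprocal of m_{0->k} is [xvec p k.+1], as [xvec p 0 = 1]. *)
have seriesE : \sum_(0 <= k <oo) (mprod (lh_mu p) 0 k.+1)^-1 =
    \sum_(0 <= k <oo) (xvec p k.+1)%:E.
  apply: eq_eseriesr => k _.
  rewrite (mprodE (fun j _ => ok j))// xvec0 inver gt_eqF ?divr_gt0//.
  by rewrite invf_div divr1.
have x0 k : 0 <= (xvec p k.+1)%:E by rewrite lee_fin ltW.
rewrite seriesE; split => [Soo i|qglob].
  have [-> _] := hQ i; congr EFin; apply: contrapT => Qi.
  have wi : (0 < surv Q i)%R.
    by rewrite /surv subr_gt0 lt_neqAle (Q_le1 hxi QE) andbT; apply/eqP.
  have B0 : (0 < C + 1)%R.
    by apply: lt_le_trans (rmean_up_le hxi hM ok hC 0); rewrite (rmean_gt0 hxi hM ok).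
  (* [extinction_sum] starts at the index [i] where survival is possible; the terms before it are
     added separately. *)
  pose b := (\sum_(0 <= k < i) xvec p k.+1 + (C + 1) / c * (xvec p i / surv Q i))%R.
  have bound n : \sum_(0 <= k < n) (xvec p k.+1)%:E <= b%:E.
    rewrite sumEFin lee_fin; apply: (@le_trans _ _ (\sum_(0 <= k < i + n) xvec p k.+1)%R).
      rewrite [leRHS](@big_cat_nat _ _ _ n)//= ?leq_addl// lerDl.
      by apply: sumr_ge0 => k _; exact: ltW.
    rewrite [leLHS](@big_cat_nat _ _ _ i)//= ?leq_addr// lerD2l.
    exact: (extinction_sum hxi hM ok QE n c0 B0 hc (rmean_up_le hxi hM ok hC) wi).
  have : \sum_(0 <= k <oo) (xvec p k.+1)%:E <= b%:E.
    apply: lime_le; first by apply: is_cvg_nneseries => k _ _; exact: x0.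
    exact: nearW.
  by rewrite Soo leye_eq.
(* A finite sum bounds both [xvec] and [beta_sum], and then [survival] applies to type 0. *)
apply/eqP; apply: contrapT => /eqP Sfin.
have [s sE] : exists s : R, \sum_(0 <= k <oo) (xvec p k.+1)%:E = s%:E.
  have : 0 <= \sum_(0 <= k <oo) (xvec p k.+1)%:E by apply: nneseries_ge0.
  by move: Sfin; case: (\big[+%E/0]_(0 <= k <oo) _) => [s _ _|//|//]; exists s.
have part n : (\sum_(0 <= k < n) xvec p k.+1 <= s)%R.
  rewrite -lee_fin -sE -sumEFin; exact: nneseries_lim_ge.
have C0 : (0 <= C)%R.
  have := le_trans (beta_ge0 hxi hM ok hC 0) (beta_le hxi hM ok hC 0).
  by rewrite pmulr_lge0.
have hx k : (xvec p k <= 1 + s)%R.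
  have s0 : (0 <= s)%R by have := part 0%N; rewrite big_geq.
  case: k => [|k]; first by rewrite xvec0 lerDl.
  apply: (@le_trans _ _ s); last by rewrite lerDr.
  by apply: le_trans (part k.+1); rewrite big_nat_recr//= lerDr sumr_ge0// => j _; exact: ltW.
have hS k : (0 <= beta_sum p k <= C * s)%R.
  rewrite /beta_sum sumr_ge0 => [|j _]; last exact: (beta_ge0 hxi hM ok hC).
  apply: (@le_trans _ _ (C * \sum_(0 <= j < k) xvec p j.+1)%R); last exact: ler_wpM2l.
  by rewrite mulr_sumr; apply: ler_sum => j _; exact: (beta_le hxi hM ok hC).
have Q1 : (Q 0 < 1)%R.
  apply: (survival hxi hM ok QE (A := fine_moment2 p) _ hS hx (rmean_beta_sum hxi hM ok hC)) => k i j ik jk.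
  by have [_ _ h _] := fine_aP hxi hM ok hC k; rewrite -h// (moment2E hxi hM ok).
have [Q0 _] := hQ 0%N; have := qglob 0%N; rewrite Q0 => -[Q0E].
by rewrite Q0E ltxx in Q1.
Qed.
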